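(* Let $n\ge2$ and $X=[T^*\mathbb{C}/D_n]$. Inequivalent scalar prequantum line bundles on $X$ with fixed curvature $-\frac{i}{\hbar}\omega$ are classified by characters $D_n\to U(1)$, equivalently by characters of the abelianization $D_n^{\mathrm{ab}}$. There are two such sectors when $n$ is odd and four when $n$ is even.
   Context: $D_n=\langle r,s\mid r^n=1,\ s^2=1,\ srs^{-1}=r^{-1}\rangle$ (order $2n$) acts on $\mathbb{C}\cong\mathbb{R}^2$ by $r(z)=e^{2\pi i/n}z$, $s(z)=\bar z$, and on $T^*\mathbb{C}\cong\mathbb{R}^4$ with coordinates $(x,y,p_x,p_y)$ by the cotangent lift (the same orthogonal matrix acting on $(x,y)$ and on $(p_x,p_y)$). The invariant symplectic form is $\omega=dp_x\wedge dx+dp_y\wedge dy$. A scalar prequantum line bundle on the global quotient $[M/G]$ is a $G$-equivariant Hermitian line bundle on $M$ with $G$-equivariant unitary connection of curvature $-\frac{i}{\hbar}\omega$; two are equivalent if there is a $G$-equivariant unitary connection-preserving isomorphism. $\hbar>0$ is fixed. *)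

(* Defs.v *)
From HB Require Import structures.
From mathcomp Require Import all_boot all_order all_algebra all_fingroup all_solvable.
From mathcomp Require Import complex ring.
From mathcomp Require Import all_classical all_reals all_analysis.

Set Implicit Arguments.
Unset Strict Implicit.
Unset Printing Implicit Defensive.

Import Order.TTheory GRing.Theory Num.Theory.
Import numFieldNormedType.Exports.


Local Open Scope ring_scope.

(** * The dihedral group *)

(** The pair [(a, b)] stands for [r ^ a * s ^ b]. For [1 < n] the type ['Z_n]
    is Z/nZ, and the presentation is [dihedral_presentation] below. *)
Definition dihedral (n : nat) : Type := ('Z_n * bool)%type.

HB.instance Definition _ (n : nat) := Finite.on (dihedral n).

Section DihedralGroup.
Variable n : nat.

Definition dihedral_mul (g h : dihedral n) : dihedral n :=
  (g.1 + (if g.2 then - h.1 else h.1), g.2 (+) h.2).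

Definition dihedral_one : dihedral n := (0, false).

Definition dihedral_inv (g : dihedral n) : dihedral n :=
  (if g.2 then g.1 else - g.1, g.2).

Fact dihedral_mulA : associative dihedral_mul.
Proof.
move=> [a [|]] [b [|]] [c [|]]; rewrite /dihedral_mul /=; congr pair;
  by rewrite ?opprD ?opprK ?addrA.
Qed.

Fact dihedral_mul1 : left_id dihedral_one dihedral_mul.
Proof. by move=> [a b]; rewrite /dihedral_mul /= add0r. Qed.

Fact dihedral_mulV : left_inverse dihedral_one dihedral_inv dihedral_mul.
Proof.
by move=> [a [|]]; rewrite /dihedral_mul /dihedral_inv /= ?subrr ?addNr.
Qed.

HB.instance Definition _ :=
  Finite_isGroup.Build (dihedral n) dihedral_mulA dihedral_mul1 dihedral_mulV.

Definition dihedral_r : dihedral n := (1, false).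
Definition dihedral_s : dihedral n := (0, true).

End DihedralGroup.

Lemma dihedral_rX n k : (dihedral_r n ^+ k)%g = (k%:R, false).
Proof.
elim: k => [|k IHk]; first by [].
by rewrite expgS IHk; congr pair; rewrite /= -natr1 addrC.
Qed.

Lemma dihedral_decomp n (g : dihedral n) :
  g = (dihedral_r n ^+ (g.1 : nat) * dihedral_s n ^+ (g.2 : nat))%g.
Proof.
rewrite dihedral_rX; case: g => a b; rewrite /= natr_Zp.
by case: b; congr pair; apply: esym; apply: addr0.
Qed.

Lemma dihedral_r_order n : (1 < n)%N -> (dihedral_r n ^+ n)%g = 1%g.
Proof. by move=> n1; rewrite dihedral_rX pchar_Zp. Qed.

Lemma dihedral_s_order n : (dihedral_s n ^+ 2)%g = 1%g.
Proof. by congr pair; rewrite /= oppr0 addr0. Qed.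

Lemma dihedral_conj n :
  (dihedral_s n * dihedral_r n * (dihedral_s n)^-1)%g = (dihedral_r n)^-1%g.
Proof. by congr pair; rewrite /= add0r oppr0 addr0. Qed.

Lemma card_dihedral n : (1 < n)%N -> #|[set: dihedral n]| = n.*2.
Proof.
by move=> n1; rewrite cardsT card_prod card_bool card_ord Zp_cast // muln2.
Qed.

Lemma dihedral_presentation n : (1 < n)%N ->
  ([set: dihedral n] \isog Grp (x : y : x ^+ n, y ^+ 2, x ^ y = x^-1))%g.
Proof.
move=> n1.
have Dn : [set: dihedral n] = (<[dihedral_r n]> <*> <[dihedral_s n]>)%g.
  apply/setP => g; rewrite inE [g]dihedral_decomp.
  by rewrite groupM // groupX // mem_gen // inE cycle_id ?orbT.
have GrpD := @Grp_dihedral n n1.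
have rs : (dihedral_r n ^ dihedral_s n)%g = (dihedral_r n)^-1%g.
  have sV : (dihedral_s n)^-1%g = dihedral_s n by [].
  by rewrite conjgE sV -{2}sV mulgA dihedral_conj.
have hom : ([set: dihedral n] \homg [set: gsort (dihedral_gtype n.*2)])%g.
  rewrite (GrpD _ [set: dihedral n]%G).
  apply/existsP; exists (dihedral_r n, dihedral_s n); apply/eqP.
  congr (_, (_, (_, _))); [exact: esym Dn | exact: dihedral_r_order
    | exact: dihedral_s_order | exact: rs].
have iso : ([set: dihedral n] \isog [set: gsort (dihedral_gtype n.*2)])%g.
  by rewrite isogEcard hom /= (@extremal.card_dihedral n) // card_dihedral.
exact: isoGrp_trans iso GrpD.
Qed.

(** * Unitary characters *)

Section Characters.
Variable R : realType.

Record character (gT : finGroupType) := Character {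
  character_fun :> gT -> R[i];
  characterM : forall g h, character_fun (g * h)%g = character_fun g * character_fun h;
  character_norm : forall g, `|character_fun g| = 1 }.

Definition abelianization (gT : finGroupType) : finGroupType :=
  coset_of [set: gT]^`(1)%g.

Definition to_ab (gT : finGroupType) : gT -> abelianization gT :=
  coset [set: gT]^`(1)%g.

Lemma to_abM (gT : finGroupType) (g h : gT) :
  to_ab (g * h)%g = (to_ab g * to_ab h)%g.
Proof.
have nG := fintype.subsetP (der_norm 1 [set: gT]%G).
by apply: morphM; apply: nG; rewrite inE.
Qed.

Definition pullback_ab (gT : finGroupType) (psi : character (abelianization gT)) :
  character gT.
Proof.
refine (@Character gT (fun g => psi (to_ab g)) _ _).
- by move=> g h; rewrite to_abM characterM.
- by move=> g; apply: character_norm.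
Defined.

End Characters.

Local Open Scope classical_set_scope.

(** * Smooth functions *)

Section Smooth.
Variables (R : realType) (V : normedModType R).

Fixpoint Ck (k : nat) (U : set V) (f : V -> R) : Prop :=
  (forall x, U x -> {for x, continuous f}) /\
  match k with
  | 0 => True
  | k.+1 => forall v, (forall x, U x -> derivable f x v) /\
                      Ck k U (fun x => 'D_v f x)
  end.

Definition smooth_on (U : set V) (f : V -> R[i]) : Prop :=
  forall k, Ck k U (fun x => complex.Re (f x)) /\ Ck k U (fun x => complex.Im (f x)).

Lemma Ck_ext k (U : set V) (f g : V -> R) : open U ->
  (forall x, U x -> f x = g x) -> Ck k U f -> Ck k U g.
Proof.
elim: k f g => [|k IHk] f g oU fg /= [fc fD].
  all: have nfg x : U x -> \near x, f x = g x
    by move=> Ux; apply: filterS (open_nbhs_nbhs (conj oU Ux)) => y; apply: fg.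
  all: split=> [x Ux|] //.
  1,2: suff : g y @[y --> x] --> g x by [].
  1,2: rewrite -(fg x Ux); apply: cvg_trans (fc x Ux).
  1,2: by apply: near_eq_cvg; apply: nfg.
move=> v; have [fv fC] := fD v; split=> [x Ux|].
  by apply: near_eq_derivable (fv x Ux); apply: nfg.
by apply: IHk fC => // x Ux; apply: near_eq_derive; apply: nfg.
Qed.

Lemma Ck_cst k (U : set V) (a : R) : Ck k U (fun=> a).
Proof.
elim: k a => [|k IHk] a /=; split=> //; try by move=> x _; apply: cst_continuous.
move=> v; split=> [x _|]; first exact: derivable_cst.
by rewrite (_ : (fun x => 'D_v (fun=> a) x) = fun=> 0) //; apply: functional_extensionality_dep => x; apply: derive_cst.
Qed.

Lemma Ck_lin k (U : set V) (a b : R) (f g : V -> R) : open U ->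
  Ck k U f -> Ck k U g -> Ck k U (fun x => a * f x + b * g x).
Proof.
move=> oU; elim: k f g => [|k IHk] f g /= [fc fD] [gc gD]; split=> //.
1,2: move=> x Ux; apply: cvgD; apply: cvgM;
  by [apply: cvg_cst | apply: fc | apply: gc].
move=> v; have [fv fC] := fD v; have [gv gC] := gD v.
have dZ (c : R) (h : V -> R) x : derivable h x v -> derivable (c \*: h) x v.
  exact: derivableZ.
split=> [x Ux|]; first by apply: derivableD; apply: dZ; [apply: fv | apply: gv].
apply: Ck_ext (IHk _ _ fC gC) => // x Ux.
have fvx := fv x Ux; have gvx := gv x Ux.
rewrite [RHS](deriveD (dZ a f x fvx) (dZ b g x gvx)).
by rewrite (deriveZ a fvx) (deriveZ b gvx).
Qed.

Lemma smooth_cst (U : set V) (a : R[i]) : smooth_on U (fun=> a).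
Proof. by move=> k; split; apply: Ck_cst. Qed.

Lemma smooth_scale (U : set V) (a : R[i]) (f : V -> R[i]) : open U ->
  smooth_on U f -> smooth_on U (fun x => a * f x).
Proof.
move=> oU fs k; have [fr fi] := fs k; case: a => a b; split.
  have := Ck_lin a (- b) oU fr fi; congr Ck; apply: functional_extensionality_dep => x.
  by case: (f x) => c d /=; rewrite mulNr.
have := Ck_lin a b oU fi fr; congr Ck; apply: functional_extensionality_dep => x.
by case: (f x) => c d.
Qed.

Definition cderive (v : V) (f : V -> R[i]) (x : V) : R[i] :=
  ('D_v (fun y => complex.Re (f y)) x +i* 'D_v (fun y => complex.Im (f y)) x)%C.

Lemma cderive_cst (v : V) (a : R[i]) x : cderive v (fun=> a) x = 0.
Proof. by rewrite /cderive !derive_cst. Qed.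

End Smooth.

(** * Phase space *)

(** T^*C = R^4 is ['M_2]: column 0 is the position (x, y) and column 1 the
    momentum (p_x, p_y), so that the cotangent lift of an orthogonal 2x2
    matrix is left multiplication. *)
Notation phase_space R := 'M[R]_2.

Section PhaseSpace.
Variable R : realType.

(** dp_x /\ dx + dp_y /\ dy *)
Definition omega (u v : phase_space R) : R :=
  \sum_(i < 2) (u i 1 * v i 0 - v i 1 * u i 0).

Definition rotation (t : R) : 'M[R]_2 :=
  \matrix_(i, j) (if i == j then cos t else if i == 0 then - sin t else sin t).

(** complex conjugation in the basis 1, i *)
Definition reflection : 'M[R]_2 :=
  \matrix_(i, j) (if i == j then (-1) ^+ i else 0).

Definition dihedral_mx (n : nat) (g : dihedral n) : 'M[R]_2 :=
  rotation (2 * pi / n%:R) ^+ (g.1 : nat) * reflection ^+ (g.2 : nat).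

Definition act (n : nat) (g : dihedral n) (x : phase_space R) : phase_space R :=
  dihedral_mx g *m x.

Lemma rotationD s t : rotation (s + t) = rotation s * rotation t.
Proof.
apply/matrixP => i j; rewrite !mxE !big_ord_recl big_ord0 !mxE cosD sinD.
case: i => [[|[|//]] ?]; case: j => [[|[|//]] ?]; rewrite /= ?addr0; ring.
Qed.

Lemma rotation0 : rotation 0 = 1.
Proof.
apply/matrixP => i j; rewrite !mxE cos0 sin0.
by case: i => [[|[|//]] ?]; case: j => [[|[|//]] ?]; rewrite /= ?oppr0.
Qed.

Lemma rotation_exp t k : rotation t ^+ k = rotation (t *+ k).
Proof.
elim: k => [|k IHk]; first by rewrite expr0 mulr0n rotation0.
by rewrite exprS IHk mulrS rotationD.
Qed.

Lemma rotation_2pi n : (0 < n)%N -> rotation (2 * pi / n%:R) ^+ n = 1.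
Proof.
move=> n0; have nz : n%:R != 0 :> R by rewrite pnatr_eq0 -lt0n.
rewrite rotation_exp; have -> : 2 * pi / n%:R *+ n = pi *+ 2 :> R.
  by rewrite -[LHS]mulr_natr divfK // mulrC mulr_natr.
rewrite -rotation0; by apply/matrixP => i j; rewrite !mxE cos2pi sin2pi cos0 sin0.
Qed.

Lemma reflection_sqr : reflection ^+ 2 = 1.
Proof.
apply/matrixP => i j; rewrite expr2 !mxE !big_ord_recl big_ord0 !mxE.
by case: i => [[|[|//]] ?]; case: j => [[|[|//]] ?]; rewrite /=; ring.
Qed.

Lemma reflection_rotation t : reflection * rotation t = rotation (- t) * reflection.
Proof.
apply/matrixP => i j; rewrite !mxE !big_ord_recl !big_ord0 !mxE cosN sinN.
by case: i => [[|[|//]] ?]; case: j => [[|[|//]] ?]; rewrite /=; ring.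
Qed.

Lemma dihedral_mx1 n : dihedral_mx (1%g : dihedral n) = 1.
Proof. by rewrite /dihedral_mx /= !expr0 mulr1. Qed.

Lemma dihedral_mxM n (g h : dihedral n) : (1 < n)%N ->
  dihedral_mx (g * h)%g = dihedral_mx g * dihedral_mx h.
Proof.
move=> n1; set rho := rotation (2 * pi / n%:R).
have rho_n : rho ^+ n = 1 by apply: rotation_2pi; apply: ltnW.
have rho_mod k : rho ^+ (k %% n) = rho ^+ k.
  by rewrite {2}(divn_eq k n) exprD mulnC exprM rho_n expr1n mul1r.
have rhoD (a b : 'Z_n) : rho ^+ (a + b)%R = rho ^+ a * rho ^+ b.
  have -> : ((a + b)%R : nat) = ((a + b) %% n)%N.
    by apply: (congr1 (modn _)); apply: Zp_cast.
  by rewrite rho_mod exprD.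
have rhoN (a : 'Z_n) : rho ^+ (- a)%R * rho ^+ a = 1 by rewrite -rhoD addNr.
have refl_rho k : rho ^+ k * (reflection * rho ^+ k) = reflection.
  by rewrite /rho rotation_exp reflection_rotation mulrA -rotationD subrr
             rotation0 mul1r.
have -> : dihedral_mx (g * h)%g =
    rho ^+ (g.1 + (if g.2 then - h.1 else h.1))%R * reflection ^+ (g.2 (+) h.2).
  by [].
case: g h => [a [|]] [b c]; rewrite /dihedral_mx -/rho [fst _]/= [snd _]/=.
  rewrite rhoD -!mulrA expr1; congr (_ * _).
  have -> : reflection * (rho ^+ b * reflection ^+ c)
      = rho ^+ (- b)%R * (reflection * reflection ^+ c).
    by rewrite -[X in _ = _ * (X * _)](refl_rho b) !mulrA rhoN mul1r.
  congr (_ * _); case: c; last exact: (esym (mulr1 _)).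
  exact: (esym reflection_sqr).
by rewrite rhoD expr0 mulr1 mulrA.
Qed.

Lemma act1 n (x : phase_space R) : act (1%g : dihedral n) x = x.
Proof. by rewrite /act dihedral_mx1 mul1mx. Qed.

Lemma actM n (g h : dihedral n) (x : phase_space R) : (1 < n)%N ->
  act (g * h)%g x = act g (act h x).
Proof. by move=> n1; rewrite /act dihedral_mxM // mulmxA. Qed.

End PhaseSpace.

(** * Prequantum line bundles *)

Section Prequantum.
Variable R : realType.
Local Notation C := R[i].
Local Notation M := (phase_space R).

(** A smooth Hermitian line bundle on M is a family of Hermitian complex lines
    with an atlas of local trivializations. A trivialization is given by its
    domain [U] and its nowhere vanishing local frame [e]: the transition
    functions are the [g] of [atlas_transition]. *)
Record line_bundle := LineBundle {
  fiber :> M -> lmodType C;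
  herm : forall x, fiber x -> fiber x -> C;
  atlas : set (set M * (forall x, fiber x));
  herm_linear : forall x (a : C) (u v w : fiber x),
    herm (a *: u + v) w = a * herm u w + herm v w;
  herm_conj : forall x (u v : fiber x), herm v u = (herm u v)^*;
  herm_pos : forall x (u : fiber x), u != 0 -> 0 < herm u u;
  atlas_open : forall U e, atlas (U, e) -> open U;
  atlas_cover : forall x, exists U e, atlas (U, e) /\ U x;
  atlas_basis : forall U e x, atlas (U, e) -> U x ->
    e x != 0 /\ forall u : fiber x, exists a : C, u = a *: e x;
  atlas_transition : forall U e U' e', atlas (U, e) -> atlas (U', e') ->
    exists2 g : M -> C, smooth_on (U `&` U') g &
      forall x, (U `&` U') x -> e' x = g x *: e x;
  herm_smooth : forall U e, atlas (U, e) ->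
    smooth_on U (fun x => herm (e x) (e x)) }.

Arguments atlas : clear implicits.

(** The section [s] is smooth on the open set [W]; its values outside of [W]
    are irrelevant. *)
Definition smooth_section (L : line_bundle) (W : set M) (s : forall x, L x) :=
  forall U e, atlas L (U, e) ->
    exists2 f : M -> C, smooth_on (W `&` U) f &
      forall x, (W `&` U) x -> s x = f x *: e x.

(** A unitary connection, as an operator on the sheaf of smooth sections:
    [nabla v s x] is the covariant derivative at [x] of a section [s] that is
    smooth around [x], in the direction of the tangent vector [v] at [x].
    Covariant derivatives of sections along constant vector fields determine
    the connection, and as constant vector fields commute the curvature
    evaluated on [u] and [v] is [nabla u \o nabla v - nabla v \o nabla u]. *)
Record unitary_connection (L : line_bundle) := UnitaryConnection {
  nabla :> M -> (forall x, L x) -> (forall x, L x);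
  nabla_smooth : forall (W : set M) v s, open W ->
    smooth_section W s -> smooth_section W (nabla v s);
  nabla_local : forall (W : set M) v s t, open W ->
    smooth_section W s -> smooth_section W t ->
    (forall x, W x -> s x = t x) -> forall x, W x -> nabla v s x = nabla v t x;
  nabla_dir : forall (W : set M) (a : R) u v s, open W -> smooth_section W s ->
    forall x, W x ->
      nabla (a *: u + v) s x = (a%:C)%C *: nabla u s x + nabla v s x;
  nablaD : forall (W : set M) v s t, open W ->
    smooth_section W s -> smooth_section W t -> forall x, W x ->
    nabla v (fun y => s y + t y) x = nabla v s x + nabla v t x;
  nabla_Leibniz : forall (W : set M) v (f : M -> C) s, open W ->
    smooth_on W f -> smooth_section W s -> forall x, W x ->
    nabla v (fun y => f y *: s y) x = cderive v f x *: s x + f x *: nabla v s x;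
  nabla_metric : forall (W : set M) v s t, open W ->
    smooth_section W s -> smooth_section W t -> forall x, W x ->
    cderive v (fun y => herm (s y) (t y)) x
      = herm (nabla v s x) (t x) + herm (s x) (nabla v t x) }.

Definition has_curvature (L : line_bundle) (nabla : unitary_connection L)
    (F : M -> M -> C) :=
  forall (W : set M) u v s, open W -> smooth_section W s -> forall x, W x ->
    nabla u (nabla v s) x - nabla v (nabla u s) x = F u v *: s x.

Definition total (L : line_bundle) (x : M) (u : L x) : {y : M & L y} :=
  existT (fun y => L y : Type) x u.

(** A D_n-equivariant line bundle with connection of curvature
    -(i / hbar) omega. The group acts on the total space [{x : M & L x}], by linear
    isometries [lift g x : L x -> L (act g x)]. The section [t] is the
    push-forward of [s] by [g] when [t (act g x) = lift g x (s x)]. *)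
Record prequantum_bundle (hbar : R) (n : nat) := PrequantumBundle {
  bundle :> line_bundle;
  connection : unitary_connection bundle;
  curvature : has_curvature connection
    (fun u v => (0 +i* - (omega u v / hbar))%C);
  lift : forall (g : dihedral n) x, {linear bundle x -> bundle (act g x)};
  lift1 : forall x (u : bundle x),
    total (lift 1%g x u) = total u;
  liftM : forall g h x (u : bundle x),
    total (lift (g * h)%g x u) = total (lift g (act h x) (lift h x u));
  lift_herm : forall g x (u v : bundle x),
    herm (lift g x u) (lift g x v) = herm u v;
  lift_smooth : forall g (W : set M) (s t : forall x, bundle x), open W ->
    (forall x, t (act g x) = lift g x (s x)) ->
    smooth_section (act g @^-1` W) s -> smooth_section W t;
  lift_connection : forall g (W : set M) v (s t : forall x, bundle x), open W ->
    (forall x, t (act g x) = lift g x (s x)) ->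
    smooth_section (act g @^-1` W) s -> forall x, W (act g x) ->
    connection (act g v) t (act g x) = lift g x (connection v s x) }.

(** Equivalence: an equivariant unitary isomorphism of smooth line bundles,
    over the identity of M, that preserves the connections. *)
Definition equivalent (hbar : R) (n : nat) (L L' : prequantum_bundle hbar n) :=
  exists phi : forall x, {linear L x -> L' x},
  [/\ forall x, bijective (phi x),
      forall x (u v : L x), herm (phi x u) (phi x v) = herm u v,
      forall (W : set M) s, open W ->
        smooth_section W s <-> smooth_section W (fun x => phi x (s x)),
      forall (W : set M) v s, open W -> smooth_section W s -> forall x, W x ->
        phi x (connection L v s x)
          = connection L' v (fun y => phi y (s y)) x &
      forall g x (u : L x), phi (act g x) (lift L g x u) = lift L' g x (phi x u)].

Lemma equivalent_refl hbar n (L : prequantum_bundle hbar n) : equivalent L L.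
Proof. by exists (fun=> idfun); split=> // x; exists id. Qed.

Lemma equivalent_trans hbar n (L1 L2 L3 : prequantum_bundle hbar n) :
  equivalent L1 L2 -> equivalent L2 L3 -> equivalent L1 L3.
Proof.
move=> [f [fb fh fs fc fg]] [g [gb gh gs gc gg]].
exists (fun x => (g x \o f x)%FUN); split=> /=.
- move=> x; have [f' ff' f'f] := fb x; have [g' gg' g'g] := gb x.
  by exists (f' \o g'); apply: can_comp.
- by move=> x u v; rewrite gh fh.
- by move=> W s oW; rewrite (fs _ _ oW) (gs _ _ oW).
- move=> W v s oW sW x Wx; rewrite (fc _ _ _ oW sW _ Wx).
  by apply: gc Wx => //; apply/fs.
- by move=> h x u; rewrite fg gg.
Qed.

Lemma equivalent_sym hbar n (L1 L2 : prequantum_bundle hbar n) :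
  equivalent L1 L2 -> equivalent L2 L1.
Proof.
move=> [f [fb fh fs fc fg]].
have inv x : {h : L2 x -> L1 x | cancel (f x) h /\ cancel h (f x)}.
  by apply: cid; have [h ? ?] := fb x; exists h.
pose h x := sval (inv x).
have fK x : cancel (f x) (h x) := (svalP (inv x)).1.
have hK x : cancel (h x) (f x) := (svalP (inv x)).2.
have h_lin x : linear (h x).
  by move=> a u v; apply: (can_inj (fK x)); rewrite linearP !hK.
pose hL x : {linear L2 x -> L1 x} :=
  HB.pack (h x) (GRing.isLinear.Build _ _ _ _ (h x) (h_lin x)).
have fhE (t : forall x, L2 x) : (fun x => f x (h x (t x))) = t.
  by apply: functional_extensionality_dep => x; rewrite hK.
exists hL; split=> /=.
- by move=> x; exists (f x) => u; [exact: hK | exact: fK].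
- by move=> x u v; rewrite -fh !hK.
- by move=> W t oW; rewrite (fs _ _ oW) fhE.
- move=> W v t oW tW x Wx; apply: (can_inj (fK x)).
  by rewrite hK (fc _ _ _ oW _ _ Wx) ?fhE //; apply/fs; rewrite // fhE.
- by move=> g x u; apply: (can_inj (fK _)); rewrite hK fg hK.
Qed.

Lemma smooth_sectionZ (L : line_bundle) (W : set M) (a : C) (s : forall x, L x) :
  open W -> smooth_section W s -> smooth_section W (fun x => a *: s x).
Proof.
move=> oW ss U e Ue; have [f fs sf] := ss U e Ue.
exists (fun x => a * f x).
  by apply: smooth_scale => //; apply: openI => //; apply: atlas_open Ue.
by move=> x Wx; rewrite sf // scalerA.
Qed.

Lemma nablaZ (L : line_bundle) (nabla : unitary_connection L) (W : set M) v
    (a : C) (s : forall x, L x) x :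
  open W -> smooth_section W s -> W x ->
  nabla v (fun y => a *: s y) x = a *: nabla v s x.
Proof.
move=> oW ss Wx.
rewrite (nabla_Leibniz nabla v oW (@smooth_cst _ _ W a) ss Wx).
by rewrite cderive_cst scale0r add0r.
Qed.

Section Twist.
Variables (hbar : R) (n : nat).
Variables (chi : character R (dihedral n)) (L : prequantum_bundle hbar n).

Lemma character_neq0 g : chi g != 0.
Proof. by rewrite -normr_eq0 character_norm oner_eq0. Qed.

Lemma character1 : chi 1%g = 1.
Proof.
by apply: (mulfI (character_neq0 1%g)); rewrite -characterM mulg1 mulr1.
Qed.

Definition twist_lift g x : {linear L x -> L (act g x)} := chi g \*: lift L g x.

Fact twist_lift1 x (u : L x) : total (twist_lift 1%g x u) = total u.
Proof. by rewrite /= character1 scale1r lift1. Qed.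

Fact twist_liftM g h x (u : L x) :
  total (twist_lift (g * h)%g x u)
    = total (twist_lift g (act h x) (twist_lift h x u)).
Proof.
rewrite /= linearZ /= scalerA -characterM; set a := chi _.
pose f (p : {y : M & L y}) := total (a *: projT2 p).
by have := congr1 f (liftM g h u).
Qed.

Lemma hermZ x (a b : C) (u v : L x) : herm (a *: u) (b *: v) = a * b^* * herm u v.
Proof.
have hZ (c : C) (w z : L x) : herm (c *: w) z = c * herm w z.
  have h0 : herm 0 z = 0.
    apply: (addrI (herm 0 z)); rewrite addr0 -{3}[0](addr0 (0 : L x)).
    by rewrite -[X in herm (X + _)](scale1r 0) herm_linear mul1r.
  by rewrite -[c *: w]addr0 herm_linear h0 addr0.
by rewrite hZ (herm_conj (b *: v) u) hZ [in RHS](herm_conj v u) rmorphM mulrA.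
Qed.

Fact twist_herm g x (u v : L x) :
  herm (twist_lift g x u) (twist_lift g x v) = herm u v.
Proof. by rewrite /= hermZ -normCK character_norm expr1n mul1r lift_herm. Qed.

Let untwist g (t : forall x, L x) x : L x := (chi g)^-1 *: t x.

Let untwistE g (s t : forall x, L x) :
  (forall x, t (act g x) = twist_lift g x (s x)) ->
  forall x, untwist g t (act g x) = lift L g x (s x).
Proof.
by move=> st x; rewrite /untwist st /= scalerA mulVf ?scale1r ?character_neq0.
Qed.

Let untwistK g t : (fun x => chi g *: untwist g t x) = t.
Proof.
apply: functional_extensionality_dep => x.
by rewrite /untwist scalerA mulfV ?scale1r ?character_neq0.
Qed.

Fact twist_smooth g (W : set M) (s t : forall x, L x) : open W ->
  (forall x, t (act g x) = twist_lift g x (s x)) ->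
  smooth_section (act g @^-1` W) s -> smooth_section W t.
Proof.
move=> oW st ss; rewrite -(untwistK g t); apply: smooth_sectionZ => //.
exact: lift_smooth oW (untwistE st) ss.
Qed.

Fact twist_connection g (W : set M) v (s t : forall x, L x) : open W ->
  (forall x, t (act g x) = twist_lift g x (s x)) ->
  smooth_section (act g @^-1` W) s -> forall x, W (act g x) ->
  connection L (act g v) t (act g x) = twist_lift g x (connection L v s x).
Proof.
move=> oW st ss x Wx; have ut := lift_smooth oW (untwistE st) ss.
rewrite -[in LHS](untwistK g t) (nablaZ _ _ _ oW ut Wx).
by rewrite (lift_connection v oW (untwistE st) ss Wx).
Qed.

(** The tensor product of [L] with the character [chi]. *)
Definition twist : prequantum_bundle hbar n :=
  PrequantumBundle (@curvature hbar n L) twist_lift1 twist_liftM twist_herm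
    twist_smooth twist_connection.

End Twist.

End Prequantum.

(* Main.v *)
(** A parallel section s of a bundle L with nabla_v s = theta_v s, where theta is the
    potential of the uniform curvature in the symmetric gauge, exists locally: in any frame the
    connection form differs from theta by a closed form, which is exact on a ball by the Poincare
    lemma. R^4 being simply connected, local sections of norm one continue along the
    segments issued from 0 and glue to a global one, S. Hence L is non-equivariantly the standard
    bundle L0. Since theta is invariant under the action, each g sends S to another parallel
    section, i.e. to chi(g) S with chi(g) a constant phase, and chi is a character; so L is the twist
    of L0 by chi. Parallel automorphisms of L0 are constant scalars, which commute with the action,
    so chi is unique. Finally s r s^-1 = r^-1 and s^2 = 1 force chi(r) and chi(s) to be signs,
    and r^n = 1 rules out chi(r) = -1 for odd n. *)

From HB Require Import structures.
From mathcomp Require Import all_boot all_order all_algebra all_fingroup all_solvable.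
From mathcomp Require Import ssrAC complex ring lra.
From mathcomp Require Import all_classical all_reals all_analysis.
Require Import Defs.

Set Implicit Arguments.
Unset Strict Implicit.
Unset Printing Implicit Defensive.

Import Order.TTheory GRing.Theory Num.Theory.
Import numFieldNormedType.Exports.

Local Open Scope ring_scope.

(** * Characters *)

(** [Ck] speaks only of iterated derivatives along constant vectors, not of a linear approximation.
    Additivity of the derivative in its direction, symmetry of mixed derivatives and continuity of
    primitives are therefore proved by hand, each by reduction to the mean value theorem on a
    segment. This is why convexity appears as closure under segments and why the Poincare lemma
    carries explicit bounds on the form and its derivatives. The symmetric gauge is chosen because
    [theta hbar v x] is a multiple of [omega x v]: it is built from [omega] and the origin alone, so
    every linear map that preserves [omega] preserves it. With this gauge the identity lift on the
    trivial bundle is already equivariant. The continuation argument is separated from the geometry: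
    it is carried out for an abstract class of sections that restricts, glues, is rigid on convex
    open sets and extends over balls whose radius depends only on the centre. *)

Lemma character_ext (R : realType) (gT : finGroupType) (chi chi' : character R gT) : chi =1 chi' -> chi = chi'.
Proof.
case: chi chi' => [f fM f1] [f' f'M f'1] /= /funext E.
by case: _ / E in f'M f'1 *; congr Character; exact: Prop_irrelevance.
Qed.

Section FiniteGroupCharacters.
Variables (R : realType) (gT : finGroupType).
Implicit Types (chi : character R gT) (g h : gT).

Lemma char_neq0 chi g : chi g != 0.
Proof. by rewrite -normr_eq0 character_norm oner_neq0. Qed.

Lemma char1 chi : chi 1%g = 1.
Proof. by apply: (mulfI (char_neq0 chi 1%g)); rewrite -characterM mulg1 mulr1. Qed.

Lemma charV chi g : chi g^-1%g = (chi g)^-1.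
Proof.
by apply: (mulfI (char_neq0 chi g)); rewrite -characterM mulgV char1 mulfV// char_neq0.
Qed.

Lemma charX chi g k : chi (g ^+ k)%g = chi g ^+ k.
Proof. by elim: k => [|k IH]; [exact: char1|rewrite expgS exprS characterM IH]. Qed.

(** The kernel of [chi] is a subgroup, and it contains every commutator because the values of [chi]
    commute. *)
Lemma char_der chi g : g \in [set: gT]^`(1)%g -> chi g = 1.
Proof.
pose K := [set x | chi x == 1].
have gK : group_set K.
  apply/group_setP; split=> [|x y]; first by rewrite inE char1.
  by rewrite !inE characterM => /eqP -> /eqP ->; rewrite mulr1.
suff /fintype.subsetP KD : ([set: gT]^`(1) \subset Group gK)%g.
  by move=> /KD; rewrite inE => /eqP.
rewrite derg1 gen_subG; apply/fintype.subsetP => _ /imset2P[x y _ _ ->].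
rewrite inE commgEl conjgE !characterM !charV.
by rewrite mulrCA mulKf ?char_neq0// mulVf ?char_neq0.
Qed.

Lemma to_ab_repr (A : abelianization gT) : to_ab (repr A) = A.
Proof. exact: coset_reprK. Qed.

Lemma char_repr chi g : chi (repr (to_ab g)) = chi g.
Proof.
have nG := fintype.subsetP (der_norm 1 [set: gT]%G).
have [|||z zD ->] := @kercoset_rcoset _ ([set: gT]^`(1))%G (repr (to_ab g)) g.
- by apply: nG; rewrite inE.
- by apply: nG; rewrite inE.
- exact: to_ab_repr.
by rewrite characterM char_der// mul1r.
Qed.

(** [chi] is constant on cosets of the derived subgroup, so its value at the representative of a
    coset defines [psi]; uniqueness is the surjectivity of [to_ab]. *)
Lemma pullback_ab_bij chi :
  exists! psi : character R (abelianization gT), chi = pullback_ab psi.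
Proof.
pose f (A : abelianization gT) := chi (repr A).
have fE g : f (to_ab g) = chi g by exact: char_repr.
have fM A B : f (A * B)%g = f A * f B.
  by rewrite -(to_ab_repr A) -(to_ab_repr B) -to_abM !fE characterM.
have f1 A : `|f A| = 1 by exact: character_norm.
exists (Character fM f1); split; first by apply: character_ext => g /=; rewrite fE.
by move=> psi E; apply: character_ext => A; rewrite /= /f E /= to_ab_repr.
Qed.

End FiniteGroupCharacters.

(** * Characters of the dihedral group as pairs of signs *)

Section DihedralCharacters.
Variables (R : realType) (n : nat).
Hypothesis n_gt1 : (1 < n)%N.
Implicit Types (chi : character R (dihedral n)) (g h : dihedral n).

(* The sign of the rotation is only available for even n: otherwise [e] is ignored. *)
Definition sign_fun (e f : bool) g : R[i] :=
  (-1) ^+ [&& e, ~~ odd n & odd g.1] * (-1) ^+ (f && g.2).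

(** Reduction modulo an even [n] does not change parity. *)
Lemma odd_Zp_add (a b : 'Z_n) : ~~ odd n -> odd (a + b)%R = odd a (+) odd b.
Proof.
move=> en; have -> : ((a + b)%R : nat) = ((a + b) %% n)%N.
  by apply: (congr1 (modn _)); exact: Zp_cast.
by rewrite -oddD {2}(divn_eq (a + b) n) [RHS]oddD oddM (negPf en) andbF.
Qed.

Lemma odd_Zp_opp (a : 'Z_n) : ~~ odd n -> odd (- a)%R = odd a.
Proof.
move=> en; have := odd_Zp_add (- a) a en; rewrite addNr /=.
by case: (odd a); case: (odd (- a)%R).
Qed.

(** A reflection in [g] replaces [h.1] by its opposite, which has the same parity when [n] is even.
    Both exponents are thus additive modulo 2. *)
Lemma sign_funM e f g h : sign_fun e f (g * h)%g = sign_fun e f g * sign_fun e f h.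
Proof.
have Ea : [&& e, ~~ odd n & odd (g * h)%g.1] =
    [&& e, ~~ odd n & odd g.1] (+) [&& e, ~~ odd n & odd h.1].
  case: e; case en : (odd n) => //=; rewrite odd_Zp_add ?en//.
  by case: (g.2); rewrite // odd_Zp_opp ?en.
have Eb : f && (g * h)%g.2 = (f && g.2) (+) (f && h.2) by case: f.
by rewrite /sign_fun Ea Eb !signr_addb mulrACA.
Qed.

Lemma sign_fun_norm e f g : `|sign_fun e f g| = 1.
Proof. by rewrite normrM !normrX normrN1 !expr1n mulr1. Qed.

Definition sign_char e f : character R (dihedral n) :=
  Character (sign_funM e f) (sign_fun_norm e f).

Lemma dihedral_rE : ((dihedral_r n).1 : nat) = 1%N.
Proof. by rewrite /= Zp_cast// modn_small. Qed.

Lemma sign_char_r e f : sign_char e f (dihedral_r n) = (-1) ^+ (e && ~~ odd n).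
Proof. by rewrite /= /sign_fun dihedral_rE /= andbF mulr1 andbT. Qed.

Lemma sign_char_s e f : sign_char e f (dihedral_s n) = (-1) ^+ f.
Proof. by rewrite /= /sign_fun /= !andbF mul1r andbT. Qed.

Lemma sqr1_sign (z : R[i]) : z ^+ 2 = 1 -> exists b : bool, z = (-1) ^+ b.
Proof.
move=> /eqP; rewrite sqrf_eq1 => /orP[/eqP ->|/eqP ->].
- by exists false.
- by exists true.
Qed.

Lemma sign_inj (b c : bool) : (-1) ^+ b = (-1) ^+ c :> R[i] -> b = c.
Proof. exact: signr_inj. Qed.

Lemma dihedral_char_ext chi chi' : chi (dihedral_r n) = chi' (dihedral_r n) ->
  chi (dihedral_s n) = chi' (dihedral_s n) -> chi = chi'.
Proof.
move=> er es; apply: character_ext => g.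
by rewrite [g]dihedral_decomp !characterM !charX er es.
Qed.

(** The clause on odd [n] fixes one pair of signs per character, since [sign_char] then ignores
    [e]. *)
Lemma dihedral_charE chi :
  exists e f, (odd n -> ~~ e) /\ chi = sign_char e f.
Proof.
have r2 : chi (dihedral_r n) ^+ 2 = 1.
  have sr : (dihedral_s n * dihedral_r n)%g = ((dihedral_r n)^-1 * dihedral_s n)%g.
    by rewrite -dihedral_conj mulgKV.
  have := congr1 chi sr; rewrite !characterM (charV chi (dihedral_r n)) mulrC.
  move=> /(mulIf (char_neq0 chi _)) E.
  by rewrite expr2 {1}E mulVf// char_neq0.
have s2 : chi (dihedral_s n) ^+ 2 = 1 by rewrite -charX dihedral_s_order char1.
have [e rE] := sqr1_sign r2; have [f sE] := sqr1_sign s2.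
have ne : odd n -> ~~ e.
  move=> on; have := congr1 chi (dihedral_r_order n_gt1).
  rewrite charX char1 rE -exprM -signr_odd oddM on andbT oddb.
  by rewrite -[1](expr0 (-1)) => /(@sign_inj e false) ->.
exists e, f; split=> //; apply: dihedral_char_ext.
  rewrite sign_char_r rE; case: (boolP (odd n)) => [/ne /negPf ->|]; first by [].
  by rewrite andbT.
by rewrite sign_char_s.
Qed.

(** The binary digits of [i] are the two signs, the high one for the rotation and the low one for
    the reflection. For odd [n] only the indices 0 and 1 exist, so the high digit is 0. *)
Definition nth_char (i : 'I_(if odd n then 2%N else 4%N)) := sign_char (1 < i)%N (odd i).

Lemma nth_char_bij chi : exists! i, chi = nth_char i.
Proof.
have [e [f [oe ->]]] := dihedral_charE chi.
have ib : ((e.*2 + f)%N < if odd n then 2 else 4)%N.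
  by case: (odd n) oe; case: e; case: f => // /(_ isT).
exists (Ordinal ib); split.
  rewrite /nth_char /=; congr sign_char; first by case: e {oe ib}; case: f.
  by rewrite oddD odd_double oddb.
move=> j E; apply: val_inj => /=.
have Ef := congr1 (fun c : character R (dihedral n) => c (dihedral_s n)) E.
have Ee := congr1 (fun c : character R (dihedral n) => c (dihedral_r n)) E.
move: Ef Ee; rewrite !sign_char_s !sign_char_r => /sign_inj -> /sign_inj.
case: j {E} => j /= jlt; case: (odd n) oe jlt => [/(_ isT)/negPf ->|_] jlt /=.
  by move: jlt; case: j => [|[|]].
by rewrite !andbT => ->; move: jlt; case: j => [|[|[|[|]]]].
Qed.

End DihedralCharacters.

Local Open Scope classical_set_scope.
Local Open Scope ring_scope.

(** * Directional derivatives *)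

Section DirectionalDerivatives.
Variables (R : realType) (V : normedModType R).
Implicit Types (f g : V -> R) (x y u v : V) (U W : set V).

(** Both sides have the same difference quotient. The chain rule and the mean value theorem of one
    real variable reach directional derivatives through this equivalence. *)
Lemma is_derive_lineP f x v (t d : R) :
  is_derive t 1 (fun s : R => f (s *: v + x)) d <-> is_derive (t *: v + x) v f d.
Proof.
have E : (fun h : R => h^-1 *: ((f \o shift (t *: v + x)) (h *: v) - f (t *: v + x)))
   = (fun h : R => h^-1 *: (((fun s : R => f (s *: v + x)) \o shift t) (h *: (1 : R))
        - f (t *: v + x))).
  apply: funext => h /=; rewrite addrA -scalerDl.
  by rewrite [h *: (1 : R)]mulr1.
split=> -[dv ev]; split.
- by rewrite /derivable E; exact: dv.
- by rewrite /derive E; exact: ev.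
- by rewrite /derivable -E; exact: dv.
- by rewrite /derive -E; exact: ev.
Qed.

Lemma is_derive_line f x v (t : R) : derivable f (t *: v + x) v ->
  is_derive t 1 (fun s : R => f (s *: v + x)) ('D_v f (t *: v + x)).
Proof. by move=> ?; apply/is_derive_lineP; apply: derivableP. Qed.

Lemma is_deriveZv f x v (a d : R) : is_derive x v f d -> is_derive x (a *: v) f (a * d).
Proof.
move=> fd; rewrite -[x]add0r -(scale0r (a *: v)); apply/is_derive_lineP.
have -> : (fun s : R => f (s *: (a *: v) + x)) =
    (fun s : R => f (s *: v + x)) \o (fun s : R => a * s).
  by apply: funext => s /=; rewrite scalerA mulrC.
have fd0 : is_derive (a * 0) 1 (fun s : R => f (s *: v + x)) d.
  by apply/is_derive_lineP; rewrite mulr0 scale0r add0r.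
have ad : is_derive (0 : R) 1 (fun s : R => a * s) a.
  by have := is_deriveZ a (is_derive_id (0 : R) 1); rewrite [_ *: _]mulr1.
by rewrite mulrC; exact: is_derive1_comp.
Qed.

Lemma is_derive_translate f w x u (d : R) :
  is_derive (w + x) u f d -> is_derive x u (fun y => f (w + y)) d.
Proof.
rewrite -[w + x]add0r -[x in X in _ -> X]add0r -(scale0r u) => /is_derive_lineP fd.
apply/is_derive_lineP; congr is_derive: fd.
by apply: funext => s; rewrite addrCA.
Qed.

Arguments is_deriveZv {f x v} a {d}.

Lemma MVT_line f x v :
  (forall t : R, 0 <= t <= 1 -> derivable f (t *: v + x) v) ->
  exists2 t, 0 <= t <= 1 & f (v + x) - f x = 'D_v f (t *: v + x).
Proof.
move=> fd; pose g (t : R) := f (t *: v + x).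
have gd (t : R) : 0 <= t <= 1 -> is_derive t 1 g ('D_v f (t *: v + x)).
  by move=> t01; apply: is_derive_line; apply: fd.
have [t||c + E] := @MVT_segment R g (fun t : R => 'D_v f (t *: v + x)) 0 1 ler01.
- by rewrite in_itv/= => /andP[t0 t1]; apply: gd; rewrite !ltW.
- by apply: derivable_within_continuous => t; rewrite in_itv/= => t01; have [] := gd t t01.
rewrite in_itv/= => c01; exists c => //.
by move: E; rewrite /g scale1r scale0r add0r subr0 mulr1.
Qed.

(** Convexity, in the parametrization of segments used by [MVT_line]. *)
Definition segment_closed W := forall x y (t : R), W x -> W y -> 0 <= t <= 1 ->
  W (t *: (y - x) + x).

Lemma ball_segment_closed x r : segment_closed (ball x r).
Proof.
move=> y z t; rewrite -ball_normE /= => yr zr /andP[t0 t1].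
have -> : x - (t *: (z - y) + y) = (1 - t) *: (x - y) + t *: (x - z).
  rewrite !scalerBl !scalerBr !scale1r opprD opprB.
  by rewrite -[RHS]addrA opprB [X in _ = _ + X]addrA subrK -[RHS]addrA (addrC (- y)).
apply: le_lt_trans (ler_normD _ _) _; rewrite !normrZ ger0_norm ?subr_ge0// ger0_norm//.
by case: (leP `|x - y| `|x - z|) => ?; nra.
Qed.

Lemma segment_closedI W W' :
  segment_closed W -> segment_closed W' -> segment_closed (W `&` W').
Proof. by move=> cW cW' x y t [Wx W'x] [Wy W'y] t01; split; [apply: cW|apply: cW']. Qed.

Lemma is_derive_cst_on W f : segment_closed W ->
  (forall x v, W x -> is_derive x v f 0) -> forall x y, W x -> W y -> f x = f y.
Proof.
move=> cW fd x y Wx Wy.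
have [t t01|t t01] := @MVT_line f x (y - x).
  by have [] := fd _ (y - x) (cW x y t Wx Wy t01).
rewrite subrK; have [_ ->] := fd _ (y - x) (cW x y t Wx Wy t01).
by move/subr0_eq.
Qed.

Lemma Ck_cont k U f x : Ck k U f -> U x -> {for x, continuous f}.
Proof. by case: k => [|k] [fc _]; apply: fc. Qed.

Lemma Ck_derivable k U f x v : Ck k.+1 U f -> U x -> derivable f x v.
Proof. by move=> [_ fd]; have [+ _] := fd v; exact. Qed.
Arguments Ck_derivable {k U f x} v.

Lemma Ck_derive k U f v : Ck k.+1 U f -> Ck k U (fun x => 'D_v f x).
Proof. by move=> [_ fd]; have [_ +] := fd v; exact. Qed.
Arguments Ck_derive {k U f} v.

Lemma Ck_sub k U W f : W `<=` U -> Ck k U f -> Ck k W f.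
Proof.
move=> WU; elim: k f => [|k IH] f [fc fd]; split=> //; try by move=> x /WU; exact: fc.
by move=> v; have [dv Cv] := fd v; split; [move=> x /WU; exact: dv|exact: IH].
Qed.

Lemma Ck_pred k U f : Ck k.+1 U f -> Ck k U f.
Proof.
elim: k f => [|k IH] f; first by case.
by move=> [fc fd]; split=> // v; have [dv Cv] := fd v; split=> //; exact: IH.
Qed.

(** [Ck] is a pointwise condition: it constrains the iterated derivatives of [f] itself at each
    point, not those of a restriction, so the set may vary with the point. *)
Lemma Ck_local k W f :
  (forall x, W x -> exists2 U, U x & Ck k U f) -> Ck k W f.
Proof.
elim: k f => [|k IH] f H.
  by split=> // x /H[U Ux [fc _]]; exact: fc.
split=> [x /H[U Ux [fc _]]|v]; first exact: fc.
split=> [x /H[U Ux [_ fd]]|]; first by have [+ _] := fd v; exact.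
by apply: IH => x /H[U Ux [_ fd]]; exists U => //; have [] := fd v.
Qed.

Lemma Ck_mul k U f g : open U -> Ck k U f -> Ck k U g ->
  Ck k U (fun x => f x * g x).
Proof.
move=> oU; elim: k f g => [|k IH] f g fC gC; split => //.
- by move=> x Ux; apply: continuousM; [exact: Ck_cont fC Ux|exact: Ck_cont gC Ux].
- by move=> x Ux; apply: continuousM; [exact: Ck_cont fC Ux|exact: Ck_cont gC Ux].
move=> v; split=> [x Ux|].
  by apply: derivableM; [exact: Ck_derivable fC Ux|exact: Ck_derivable gC Ux].
apply: (@Ck_ext _ _ _ _ (fun x => 1 * (f x * 'D_v g x) + 1 * (g x * 'D_v f x))) => //.
  move=> x Ux; have /= := deriveM (Ck_derivable v fC Ux) (Ck_derivable v gC Ux).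
  by move=> E; rewrite !mul1r; exact/esym/E.
apply: Ck_lin => //; apply: IH; try exact: Ck_derive; exact: Ck_pred.
Qed.

Lemma open_ball U x : open U -> U x -> exists2 r, 0 < r & ball x r `<=` U.
Proof. by move=> oU Ux; exact/nbhs_ballP/open_nbhs_nbhs. Qed.

(** The difference quotient along [u + v] is the one along [u] at [x] plus one along [v] at the
    moved base point [h *: u + x]. By the mean value theorem the latter is a value of ['D_v f] near
    [x], and ['D_v f] is continuous there. *)
Lemma is_deriveDv U f x u v : open U -> Ck 1 U f -> U x ->
  is_derive x (u + v) f ('D_u f x + 'D_v f x).
Proof.
move=> oU fC Ux; have fdu : derivable f x u := Ck_derivable u fC Ux.
have lim : (fun h : R => h^-1 *: ((f \o shift x) (h *: (u + v)) - f x)) @ 0^'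
    --> 'D_u f x + 'D_v f x.
  have -> : (fun h : R => h^-1 *: ((f \o shift x) (h *: (u + v)) - f x)) =
     (fun h : R => h^-1 *: ((f \o shift x) (h *: u) - f x) +
               h^-1 *: (f (h *: v + (h *: u + x)) - f (h *: u + x))).
    apply: funext => h; rewrite -scalerDr /=; congr (_ *: _).
    by rewrite scalerDr (addrC (h *: u)) -[h *: v + _ + x]addrA; ring.
  apply: cvgD; first exact: fdu.
  have Dc : {for x, continuous ('D_v f)} := Ck_cont (Ck_derive v fC) Ux.
  apply/cvgrPdist_le => /= e e0.
  have /nbhs_ballP[r r0 rB] : \forall y \near x, U y /\ `|'D_v f x - 'D_v f y| <= e.
    near=> y; split; first by near: y; exact: open_nbhs_nbhs.
    by near: y; move/cvgrPdist_le : Dc; apply.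
  have N0 : 0 < `|u| + `|v| + 1 by rewrite ltr_wpDl// addr_ge0.
  (* For such [h] the points [t *: (h *: v) + (h *: u + x)] with [t] in [0, 1] stay in the ball of
     radius [r]; the summand 1 keeps the denominator positive. *)
  exists (r / (`|u| + `|v| + 1)); first exact: divr_gt0.
  move=> h /=; rewrite sub0r normrN ltr_pdivlMr// => hr hn0.
  have inB (t : R) : 0 <= t <= 1 -> ball x r (t *: (h *: v) + (h *: u + x)).
    move=> /andP[t0 t1]; rewrite -ball_normE /= addrA opprD addrCA subrr addr0.
    rewrite normrN; apply: le_lt_trans (ler_normD _ _) _; rewrite !normrZ (ger0_norm t0).
    have := ler_piMl (mulr_ge0 (normr_ge0 h) (normr_ge0 v)) t1.
    have := normr_ge0 h; lra.
  have dB y : ball x r y -> is_derive y (h *: v) f (h * 'D_v f y).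
    by move=> /rB[Uy _]; apply/is_deriveZv/derivableP/(Ck_derivable v fC Uy).
  have [t t01|t t01 ->] := @MVT_line f (h *: u + x) (h *: v).
    by have [] := dB _ (inB t t01).
  have [_ ->] := dB _ (inB t t01).
  rewrite -[_ *: _]/(_ * _) mulKf//.
  by have [_] := rB _ (inB t t01).
split; first by apply/cvg_ex; eexists; exact: lim.
by apply: cvg_lim lim.
Unshelve. all: end_near. Qed.

Lemma derive_lin U f x (a : R) u v : open U -> Ck 1 U f -> U x ->
  'D_(a *: u + v) f x = a * 'D_u f x + 'D_v f x.
Proof.
move=> oU fC Ux; have [_ ->] := is_deriveDv (a *: u) v oU fC Ux.
by have [_ ->] := is_deriveZv a (derivableP (Ck_derivable u fC Ux)).
Qed.

(* The second difference of f, being symmetric in u and v, computes both mixed derivatives. *)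
Lemma second_difference U f x u v e : open U -> Ck 2 U f -> U x -> 0 < e ->
  \forall h \near 0^', `| 'D_v (fun y => 'D_u f y) x -
    h^-1 * h^-1 * (f (h *: v + (h *: u + x)) - f (h *: u + x) - (f (h *: v + x) - f x))| <= e.
Proof.
move=> oU fC Ux e0; have duC := Ck_derive u fC.
have Dc := Ck_cont (Ck_derive v duC) Ux.
have /nbhs_ballP[r r0 rB] : \forall y \near x,
    U y /\ `|'D_v (fun y => 'D_u f y) x - 'D_v (fun y => 'D_u f y) y| <= e.
  near=> y; split; first by near: y; exact: open_nbhs_nbhs.
  by near: y; move/cvgrPdist_le : Dc; apply.
have N0 : 0 < `|u| + `|v| + 1 by rewrite ltr_wpDl// addr_ge0.
exists (r / (`|u| + `|v| + 1)); first exact: divr_gt0.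
move=> h /=; rewrite sub0r normrN ltr_pdivlMr// => hr hn0.
have inB (t s : R) : 0 <= t <= 1 -> 0 <= s <= 1 ->
    ball x r (t *: (h *: v) + (s *: (h *: u) + x)).
  move=> /andP[t0 t1] /andP[s0 s1].
  rewrite -ball_normE /= addrA opprD addrCA subrr addr0.
  rewrite normrN; apply: le_lt_trans (ler_normD _ _) _.
  rewrite !normrZ (ger0_norm t0) (ger0_norm s0).
  have := ler_piMl (mulr_ge0 (normr_ge0 h) (normr_ge0 v)) t1.
  have := ler_piMl (mulr_ge0 (normr_ge0 h) (normr_ge0 u)) s1.
  have := normr_ge0 h; lra.
have i0 : 0 <= (0 : R) <= 1 by rewrite lexx ler01.
have i1 : 0 <= (1 : R) <= 1 by rewrite lexx ler01.
(* The second difference is the increment of [g] along [h *: u]. A mean value in the direction [u],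
   then one for ['D_u f] in the direction [v], leave [h * h] times the mixed derivative at a point
   of the ball. *)
pose g := fun y => f (h *: v + y) - f y.
have gd (t : R) : 0 <= t <= 1 -> is_derive (t *: (h *: u) + x) (h *: u) g
    (h * 'D_u f (h *: v + (t *: (h *: u) + x)) - h * 'D_u f (t *: (h *: u) + x)).
  move=> t01.
  have ud y : U y -> is_derive y (h *: u) f (h * 'D_u f y).
    by move=> Uy; apply/is_deriveZv/derivableP/(Ck_derivable u (Ck_pred fC) Uy).
  apply: is_deriveB.
    apply: is_derive_translate; apply: ud.
    by have := inB 1 t i1 t01; rewrite scale1r => /rB[].
  by apply: ud; have := inB 0 t i0 t01; rewrite scale0r add0r => /rB[].
have [t t01|t t01 E] := @MVT_line g x (h *: u); first by have [] := gd t t01.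
rewrite /g in E; rewrite E; have [_ ->] := gd t t01.
have [s s01|s s01] := @MVT_line ('D_u f) (t *: (h *: u) + x) (h *: v).
  have [Uy _] := rB _ (inB s t s01 t01).
  by have [] := is_deriveZv h (derivableP (Ck_derivable v duC Uy)).
have [Uy dle] := rB _ (inB s t s01 t01).
have [_ ->] := is_deriveZv h (derivableP (Ck_derivable v duC Uy)).
rewrite -mulrBr => ->; rewrite -mulrA mulKf// mulKf//.
Unshelve. all: end_near. Qed.

Lemma derive_comm U f x u v : open U -> Ck 2 U f -> U x ->
  'D_v (fun y => 'D_u f y) x = 'D_u (fun y => 'D_v f y) x.
Proof.
move=> oU fC Ux; apply/eqP; rewrite -subr_eq0 -normr_le0; apply/ler_addgt0Pl => e e0.
rewrite addr0; have e20 : 0 < e / 2 by rewrite divr_gt0.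
near (0 : R)^' => h.
have : `| 'D_v (fun y => 'D_u f y) x - h^-1 * h^-1 *
    (f (h *: v + (h *: u + x)) - f (h *: u + x) - (f (h *: v + x) - f x))| <= e / 2.
  by near: h; exact: second_difference fC Ux e20.
have : `| 'D_u (fun y => 'D_v f y) x - h^-1 * h^-1 *
    (f (h *: u + (h *: v + x)) - f (h *: v + x) - (f (h *: u + x) - f x))| <= e / 2.
  by near: h; exact: second_difference fC Ux e20.
have -> : f (h *: u + (h *: v + x)) - f (h *: v + x) - (f (h *: u + x) - f x) =
   f (h *: v + (h *: u + x)) - f (h *: u + x) - (f (h *: v + x) - f x).
  by rewrite [h *: u + (h *: v + x)]addrCA; ring.
set q := _ * (_ - _ - _) => h1 h2.
rewrite -(subrKA q) [e]splitr; apply: le_trans (ler_normD _ _) _.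
by rewrite [X in _ + X]distrC; exact: lerD h2 h1.
Unshelve. all: end_near. Qed.

End DirectionalDerivatives.
Arguments Ck_derivable {R V k U f x} v.
Arguments Ck_derive {R V k U f} v.
Arguments is_deriveZv {R V f x v} a {d}.

(** * Linear functions and composition with linear maps *)

Section LinearMaps.
Variables (R : realType) (V V' : normedModType R).
Implicit Types (l : V -> R) (f : V' -> R) (B : V -> V') (x v : V) (U : set V) (W : set V').

Lemma is_derive_linear l x v :
  linear l -> is_derive x v l (l v).
Proof.
move=> ll; have lim : (fun h : R => h^-1 *: ((l \o shift x) (h *: v) - l x)) @ 0^' --> l v.
  apply: cvg_near_cst; near=> h; rewrite /= ll addrK scalerA mulVf ?scale1r//.
  by near: h; exact: nbhs_dnbhs_neq.
by split; [apply/cvg_ex; eexists; exact: lim|apply: cvg_lim lim].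
Unshelve. all: end_near. Qed.

Lemma Ck_linear k U l : linear l -> continuous l ->
  Ck k U l.
Proof.
case: k => [|k] ll lc; first by split=> // x _; exact: lc.
split=> [x _|v]; first exact: lc.
split=> [x _|]; first by have [] := is_derive_linear x v ll.
rewrite (_ : (fun x : V => 'D_v l x) = fun=> l v); first exact: Ck_cst.
by apply: funext => x; have [] := is_derive_linear x v ll.
Qed.

(** The two difference quotients are the same function of [h], whence an equality between the
    derivability statements as well. *)
Lemma derivable_comp_linear f B x v :
  linear B ->
  derivable (f \o B) x v = derivable f (B x) (B v) /\ 'D_v (f \o B) x = 'D_(B v) f (B x).
Proof.
move=> lB; have E : (fun h : R => h^-1 *: (((f \o B) \o shift x) (h *: v) - (f \o B) x)) =
    (fun h : R => h^-1 *: ((f \o shift (B x)) (h *: B v) - f (B x))).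
  by apply: funext => h /=; rewrite lB.
by split; [rewrite /derivable E|rewrite /derive E].
Qed.

Lemma Ck_comp_linear k W f B :
  linear B -> continuous B -> Ck k W f -> Ck k (B @^-1` W) (f \o B).
Proof.
move=> lB cB; elim: k f => [|k IH] f [fc fd]; split => //.
- by move=> x Wx; apply: continuous_comp; [exact: cB|exact: fc].
- by move=> x Wx; apply: continuous_comp; [exact: cB|exact: fc].
move=> v; have [dv Cv] := fd (B v); split=> [x Wx|].
  by have [-> _] := derivable_comp_linear f x v lB; exact: dv.
rewrite (_ : (fun x : V => 'D_v (f \o B) x) = (fun y : V' => 'D_(B v) f y) \o B); first exact: IH.
by apply: funext => x; have [_ ->] := derivable_comp_linear f x v lB.
Qed.

End LinearMaps.

(** * The Poincare lemma on a ball *)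

Section Poincare.
Variables (R : realType) (V : normedModType R).
Implicit Types (x y u v w : V).
Local Notation mu := lebesgue_measure.

Lemma continuous_line (f : V -> R) w x (t : R) :
  {for t *: w + x, continuous f} -> {for t, continuous (fun s : R => f (s *: w + x))}.
Proof.
move=> fc; apply: (@continuous_comp _ _ _ (fun s : R => s *: w + x) f) => //.
by apply: cvgD; [exact: scalel_continuous|exact: cvg_cst].
Qed.

(** [a v y] is the value at [y] of a closed one-form on the vector [v]. The uniform bounds supply
    the dominating constant for differentiation under the integral sign; the first one also gives
    continuity of primitives. *)
Variables (c : V) (r K : R) (a : V -> V -> R).
Local Notation W := (ball c r).
Hypothesis a_lin : forall (k : R) u v y, W y -> a (k *: u + v) y = k * a u y + a v y.
Hypothesis aC1 : forall v, Ck 1 W (a v).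
Hypothesis a_closed : forall u v y, W y -> 'D_u (a v) y = 'D_v (a u) y.
Hypothesis a_bound : forall v y, W y -> `|a v y| <= K * `|v|.
Hypothesis da_bound : forall u v y, W y -> `|'D_u (a v) y| <= K * `|u| * `|v|.

(* By closedness the derivative of the integrand in the direction v is the t-derivative of
   t * a v (t *: (y - c) + c). *)
Definition radial_primitive y : R :=
  \int[mu]_(t in `[0, 1]) a (y - c) (t *: (y - c) + c).

Let integrable01 (f : R -> R) : {in `[0, 1], forall t, {for t, continuous f}} ->
  mu.-integrable `[0, 1] (EFin \o f).
Proof.
move=> fc; apply: continuous_compact_integrable; first exact: segment_compact.
by apply: continuous_in_subspaceT => t; rewrite inE => /= t01; apply: fc.
Qed.

Lemma is_derive_radial_primitive y v : W y -> is_derive y v radial_primitive (a v y).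
Proof.
move=> Wy; set w := y - c; have wr : `|w| < r by move: Wy; rewrite -ball_normE /= distrC.
(* For [s] smaller than [d] in absolute value, [s *: v + w] has norm less than [r], so the points
   [z s t] stay in [W]. *)
pose d := (r - `|w|) / (`|v| + 1).
have v1 : 0 < `|v| + 1 by rewrite ltr_wpDl.
have d0 : 0 < d by rewrite divr_gt0// subr_gt0.
pose z (s t : R) := t *: (s *: v + w) + c.
have zW s t : s \in `]- d, d[ -> t \in `[0, 1] -> W (z s t).
  rewrite !in_itv /= => sd /andP[t0 t1].
  have sd' : `|s| < d by rewrite ltr_norml.
  rewrite -ball_normE /= /z opprD addrCA subrr addr0 normrN normrZ ger0_norm//.
  have H1 : `|s| * (`|v| + 1) < r - `|w| by rewrite -ltr_pdivlMr.
  have H2 := ler_normD (s *: v) w; rewrite normrZ in H2.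
  have H3 := ler_piMl (normr_ge0 (s *: v + w)) t1.
  have := normr_ge0 s; lra.
(* The integrand of the primitive at [s *: v + y], expanded by linearity of [a] in its direction;
   [f'] is its derivative in [s]. *)
pose f (s t : R) := s * a v (z s t) + a w (z s t).
have zE s t : z s t = s *: (t *: v) + (t *: w + c).
  by rewrite /z scalerDr addrA !scalerA mulrC.
pose f' (s t : R) := s * (t * 'D_v (a v) (z s t)) + a v (z s t) + t * 'D_v (a w) (z s t).
have az s t u : s \in `]- d, d[ -> t \in `[0, 1] ->
    is_derive s 1 (fun s => a u (z s t)) (t * 'D_v (a u) (z s t)).
  move=> sI tI; under eq_fun do rewrite zE.
  rewrite zE; apply/is_derive_lineP/is_deriveZv/derivableP/Ck_derivable; first exact: aC1.
  by rewrite -zE; apply: zW.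
have fd s t : s \in `]- d, d[ -> t \in `[0, 1] -> is_derive s 1 (f ^~ t) (f' s t).
  move=> sI tI; apply: is_deriveD; last exact: az.
  have := is_deriveM (is_derive_id s 1) (az s t v sI tI).
  by rewrite [_%:A]mulr1.
have I0 : 0 \in `]- d, d[ by rewrite in_itv /= oppr_lt0 d0.
have az_cont s u : s \in `]- d, d[ ->
    {in `[0, 1], forall t, {for t, continuous (fun t => a u (z s t))}}.
  by move=> sI t tI; apply: continuous_line; apply: (Ck_cont (aC1 u)); apply: zW.
have f_cont s : s \in `]- d, d[ -> {in `[0, 1], forall t, {for t, continuous (f s)}}.
  move=> sI t tI; apply: continuousD; last exact: az_cont.
  by apply: continuousM; [exact: cst_continuous|exact: az_cont].
(* Bounds the three terms of [f'] separately, with [s] at most [d] in absolute value and [t] at most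
   1. *)
pose G := d * (K * `|v| * `|v|) + K * `|v| + K * `|v| * `|w|.
have f'_bound s t : s \in `]- d, d[ -> t \in `[0, 1] -> `|f' s t| <= G.
  move=> sI tI; have Wz := zW s t sI tI.
  move: (tI) sI; rewrite !in_itv /= => /andP[t0 t1] sd'.
  have sd : `|s| <= d by rewrite ltW// ltr_norml.
  apply: le_trans (ler_normD _ _) _; apply: lerD.
    apply: le_trans (ler_normD _ _) _; apply: lerD; last exact: a_bound.
    rewrite normrM; apply: ler_pM => //; rewrite normrM (ger0_norm t0).
    by apply: le_trans (da_bound v v Wz); exact: ler_piMl.
  rewrite normrM (ger0_norm t0); apply: le_trans (da_bound v w Wz); exact: ler_piMl.
have d1f s t : s \in `]- d, d[ -> t \in `[0, 1] -> partial1of2 f s t = f' s t.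
  by move=> sI tI; rewrite partial1of2E; have [_] := fd s t sI tI.
have G0 : 0 <= G.
  apply: le_trans (f'_bound 0 0 I0 _); first exact: normr_ge0.
  by rewrite in_itv /= lexx ler01.
have := @cvg_differentiation_under_integral R _ _ mu f `[0, 1] _ 0 (- d) d.
move=> /(_ _ I0) H.
have {}H : h^-1 *: (\int[mu]_(t in `[0, 1]) f (h + 0) t - \int[mu]_(t in `[0, 1]) f 0 t)
    @[h --> 0^'] --> \int[mu]_(t in `[0, 1]) (partial1of2 f) 0 t.
  apply: (H _ _ _ (fun=> G)) => //.
  - by move=> s sI; apply/integrable01/f_cont.
  - by move=> s t sI tI; have [] := fd s t sI tI.
  - by apply: integrable01 => t _; exact: cst_continuous.
  - by move=> s t sI tI; rewrite d1f// f'_bound.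
have z0E (t : R) : z 0 t = t *: w + c by rewrite /z scale0r add0r.
pose g (t : R) := t * a v (t *: w + c).
pose g' (t : R) := a v (t *: w + c) + t * 'D_w (a v) (t *: w + c).
have zW0 (t : R) : t \in `[0, 1] -> W (t *: w + c) by move=> tI; rewrite -z0E; exact: zW.
have gd (t : R) : t \in `[0, 1] -> is_derive t 1 g (g' t).
  move=> tI; have avd : is_derive t 1 (fun s : R => a v (s *: w + c)) ('D_w (a v) (t *: w + c)).
    by apply: is_derive_line; apply: Ck_derivable (zW0 t tI); exact: aC1.
  have := is_deriveM (is_derive_id t 1) avd.
  by rewrite [_%:A]mulr1 addrC.
have g'c : {in `[0, 1], forall t, {for t, continuous g'}}.
  move=> t tI; apply: continuousD.
    by apply: continuous_line; apply: (Ck_cont (aC1 v)); apply: zW0.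
  apply: continuousM; first by move=> ?; exact.
  by apply: (@continuous_line ('D_w (a v))); apply: (Ck_cont (Ck_derive w (aC1 v))); apply: zW0.
have intE : \int[mu]_(t in `[0, 1]) (partial1of2 f) 0 t = a v y.
  transitivity (\int[mu]_(t in `[0, 1]) g' t).
    apply: eq_Rintegral => t; rewrite inE /= => tI.
    rewrite d1f// /f' z0E mul0r add0r /g'; congr (_ + _ * _).
    by apply: a_closed; exact: zW0.
  rewrite /Rintegral (@continuous_FTC2 _ g' g 0 1)//=.
  - by rewrite /g mul0r mul1r subr0 scale1r subrK.
  - by apply: continuous_in_subspaceT => t; rewrite inE => /= tI; apply: g'c.
  - have gcont (t : R) : t \in `[0, 1] -> {for t, continuous g}.
      by move=> /gd[gt _]; apply/differentiable_continuous/derivable1_diffP.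
    split.
    + by move=> t tI; have [] := gd t (subset_itv_oo_cc tI).
    + by apply: cvg_at_right_filter; apply: gcont; rewrite in_itv /= lexx ler01.
    + by apply: cvg_at_left_filter; apply: gcont; rewrite in_itv /= lexx ler01.
  - move=> t tI; rewrite derive1E.
    by have [_ ->] := gd t (subset_itv_oo_cc tI).
have F0 : is_derive (0 : R) 1 (fun s : R => \int[mu]_(t in `[0, 1]) f s t) (a v y).
  rewrite -intE; have E : (fun h : R => h^-1 *: (((fun s : R => \int[mu]_(t in `[0, 1]) f s t)
      \o shift 0) (h *: (1 : R)) - \int[mu]_(t in `[0, 1]) f 0 t)) =
    (fun h : R => h^-1 *: (\int[mu]_(t in `[0, 1]) f (h + 0) t - \int[mu]_(t in `[0, 1]) f 0 t)).
    by apply: funext => h /=; rewrite [_%:A]mulr1.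
  split; last by rewrite /derive E; apply: cvg_lim H.
  by rewrite /derivable E; apply/cvg_ex; eexists; exact: H.
have : is_derive (0 : R) 1 (fun s : R => radial_primitive (s *: v + y)) (a v y).
  (* Linearity of [a] is known on [W] only, so the integral of [f s] is identified with the
     primitive only for [s] near 0. *)
  apply: near_eq_is_derive F0.
  near=> s; have sI : s \in `]- d, d[.
    by near: s; apply: near_in_itv; rewrite in_itv /= oppr_lt0 d0.
  apply: eq_Rintegral => t; rewrite inE /= => tI.
  rewrite -addrA -/w a_lin//; last exact: zW.
by move/is_derive_lineP; rewrite scale0r add0r.
Unshelve. all: end_near. Qed.

(** Derivatives in all directions do not imply continuity; the bound [K] makes [F] Lipschitz on the
    convex ball. *)
Lemma is_derive_bounded_continuous (F : V -> R) y :
  (forall x v, W x -> is_derive x v F (a v x)) -> W y -> {for y, continuous F}.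
Proof.
move=> Fa Wy; apply/cvgrPdist_le => /= e e0.
(* [K] may be zero or negative, so a positive constant above it is used for the division. *)
have K0 : 0 < `|K| + 1 by rewrite ltr_wpDl.
near=> x; have Wx : W x by near: x; apply: open_nbhs_nbhs; split => //; exact: ball_open.
have FaD (t : R) : 0 <= t <= 1 -> is_derive (t *: (y - x) + x) (y - x) F
    (a (y - x) (t *: (y - x) + x)).
  by move=> t01; apply: Fa; exact: ball_segment_closed.
have [t t01|t t01 +] := @MVT_line _ _ F x (y - x); first by have [] := FaD t t01.
have [_ ->] := FaD t t01; rewrite subrK => ->.
apply: le_trans (a_bound _ _) _; first exact: ball_segment_closed.
apply: (@le_trans _ _ ((`|K| + 1) * `|y - x|)).
  by rewrite ler_wpM2r// (le_trans (ler_norm _))// lerDl.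
rewrite mulrC -ler_pdivlMr//.
by near: x; apply: cvgr_dist_le => //; exact: divr_gt0.
Unshelve. all: end_near. Qed.

End Poincare.

(** * Continuation of local sections along segments *)

Section Monodromy.
Variables (R : realType) (V : normedModType R).
Implicit Types (x y : V) (W : set V) (t r : R).

(** The open [r]-neighbourhood of the segment from 0 to [t *: x]. Its convexity makes rigidity
    applicable to it and to its intersections with balls and other tubes. *)
Definition tube x t r : set V := [set y | exists2 a : R, 0 <= a <= t & `|y - a *: x| < r].

Lemma open_tube x t r : open (tube x t r).
Proof.
have -> : tube x t r = \bigcup_(a in [set a : R | 0 <= a <= t]) ball (a *: x) r.
  apply/seteqP; split=> y.
    by case=> a at_ ya; exists a => //; rewrite -ball_normE /= distrC.
  by case=> a at_; rewrite -ball_normE /= distrC => ya; exists a.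
by apply: bigcup_open => a _; exact: ball_open.
Qed.

Lemma tube_segment_closed x t r : segment_closed (tube x t r).
Proof.
move=> y z s [a /andP[a0 at_] ya] [b /andP[b0 bt] zb] /andP[s0 s1].
exists (a + s * (b - a)); first by apply/andP; split; nra.
have -> : s *: (z - y) + y - (a + s * (b - a)) *: x =
    (1 - s) *: (y - a *: x) + s *: (z - b *: x).
  rewrite !scalerBr !scalerBl !scale1r scalerDl mulrBr scalerBl !scalerA.
  move: (s *: z) (s *: y) (a *: x) => p q w; move: ((s * a) *: x) ((s * b) *: x) => u v.
  by rewrite !opprD !opprK !addrA (ACl (3*2*4*6*1*5)).
apply: le_lt_trans (ler_normD _ _) _; rewrite !normrZ ger0_norm ?subr_ge0// ger0_norm//.
by case: (leP `|y - a *: x| `|z - b *: x|) => ?; nra.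
Qed.

(** [good] abstracts the sheaf of unit parallel sections. In [good_ext] the radius depends on the
    centre [x] and not on the section, which lets the continuation pass beyond the supremum of the
    times reached. *)
Variable T : V -> Type.
Variable good : set V -> (forall x, T x) -> Prop.
Hypothesis good_sub : forall W W' s, open W' -> W' `<=` W -> good W s -> good W' s.
Hypothesis good_local : forall W s, open W ->
  (forall x, W x -> exists W' s', [/\ open W', W' x, good W' s' &
    forall y, W' y -> W y -> s y = s' y]) -> good W s.
Hypothesis good_rigid : forall W s s' x, open W -> segment_closed W ->
  good W s -> good W s' -> W x -> s x = s' x -> forall y, W y -> s y = s' y.
Hypothesis good_start : exists W s, [/\ open W, W 0 & good W s].
Hypothesis good_ext : forall x, exists2 r, 0 < r &
  forall W s y, open W -> good W s -> W y -> ball x r y ->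
    exists2 s', good (ball x r) s' & s' y = s y.

(* Supremum argument on the largest t such that s0 extends to a tube around [0, t x]. *)
Lemma tube_good : exists s0 : forall x, T x, forall x, exists2 d, 0 < d &
  exists2 s, good (tube x 1 d) s & s 0 = s0 0.
Proof.
have [W0 [s0 [oW0 W00 gs0]]] := good_start.
exists s0 => x.
pose Q (t : R) := 0 <= t <= 1 /\ exists2 d, 0 < d & exists2 s, good (tube x t d) s & s 0 = s0 0.
have Q0 : Q 0.
  split; first by rewrite lexx ler01.
  have [d d0 dW] := open_ball oW0 W00.
  exists d => //; exists s0 => //; apply: good_sub gs0; first exact: open_tube.
  move=> y [a]; rewrite -eq_le => /eqP <-; rewrite scale0r subr0 => yd.
  by apply: dW; rewrite -ball_normE /= sub0r normrN.
have hQ : has_sup Q by split; [exists 0|exists 1 => t [/andP[]]].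
set tau := sup Q.
have [r r0 ext] := good_ext (tau *: x).
have x0 : 0 < `|x| + 1 by rewrite ltr_wpDl.
(* Moving the parameter by at most [e] moves the point on the segment by at most [r / 4]. *)
pose e := r / (4 * (`|x| + 1)).
have e0 : 0 < e by rewrite divr_gt0// mulr_gt0.
have ex : e * `|x| <= r / 4.
  rewrite /e invfM mulrA -mulrA ler_piMr ?divr_ge0 ?ltW//.
  by rewrite mulrC ltr_pdivrMr// mul1r ltrDl.
have [t1 [/andP[t10 t11] [d1 d10 [s1 gs1 s10]]] tau_t1] := sup_adherent e0 hQ.
rewrite -/tau in tau_t1; have t1tau : t1 <= tau by apply: sup_upper_bound => //; split; [apply/andP|exists d1 => //; exists s1].
have t1x : tube x t1 d1 (t1 *: x) by exists t1; rewrite ?t10 ?lexx// subrr normr0.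
have near_tau a : `|a - tau| <= e -> `|a *: x - tau *: x| <= r / 4.
  by move=> ae; rewrite -scalerBl normrZ (le_trans _ ex)// ler_wpM2r.
have [|s' gs' s't1] := ext _ _ _ (open_tube x t1 d1) gs1 t1x.
  rewrite -ball_normE /= distrC; apply: le_lt_trans (near_tau t1 _) _.
    by rewrite ler_norml; apply/andP; split; lra.
  by lra.
pose t2 := Num.min 1 (tau + e).
(* A point of the new tube is within [r / 4] of some [a *: x]. Either [a <= t1] and the point is in
   the old tube, or [a *: x] is within [r / 4] of [tau *: x] and the point is in the ball. *)
pose d := Num.min d1 (r / 4).
pose s y := if pselect (tube x t1 d1 y) then s1 y else s' y.
(* The overlap of tube and ball is convex and contains [t1 *: x], where the two sections agree by
   the choice of [s']. *)
have s_eq y : ball (tau *: x) r y -> s y = s' y.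
  rewrite /s; case: pselect => //= ty By.
  apply: (good_rigid (W := tube x t1 d1 `&` ball (tau *: x) r) (x := t1 *: x)) => //.
  - by apply: openI; [exact: open_tube|exact: ball_open].
  - by apply: segment_closedI; [exact: tube_segment_closed|exact: ball_segment_closed].
  - by apply: good_sub gs1; [apply: openI; [exact: open_tube|exact: ball_open]|move=> z []].
  - by apply: good_sub gs'; [apply: openI; [exact: open_tube|exact: ball_open]|move=> z []].
  - split=> //; rewrite -ball_normE /= distrC; apply: le_lt_trans (near_tau t1 _) _.
      by rewrite ler_norml; apply/andP; split; lra.
    by lra.
have t1t2 : t1 <= t2 by rewrite le_min t11; lra.
have t21 : t2 <= 1 by rewrite ge_min lexx.
have t2e : t2 <= tau + e by rewrite ge_min lexx orbT.
have Q2 : Q t2.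
  split; first by rewrite t21 andbT (le_trans t10).
  have d_gt0 : 0 < d by rewrite lt_min d10 divr_gt0.
  have dd1 : d <= d1 by rewrite ge_min lexx.
  have dr4 : d <= r / 4 by rewrite ge_min lexx orbT.
  exists d => //; exists s; last first.
    rewrite /s; case: pselect => //= -[]; exists 0; first by rewrite lexx.
    by rewrite scale0r subr0 normr0.
  apply: good_local; first exact: open_tube.
  move=> y [a /andP[a0 at2] ya]; have [at1|t1a] := leP a t1.
    exists (tube x t1 d1), s1; split=> //; first exact: open_tube.
      by exists a; [rewrite a0|exact: lt_le_trans dd1].
    by move=> z tz _; rewrite /s; case: pselect.
  exists (ball (tau *: x) r), s'; split=> //; first exact: ball_open.
    rewrite -ball_normE /= distrC -(subrKA (a *: x)).
    apply: le_lt_trans (ler_normD _ _) _.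
    have : `|a *: x - tau *: x| <= r / 4.
      by apply: near_tau; rewrite ler_norml; apply/andP; split; lra.
    by lra.
  by move=> z Bz _; exact: s_eq.
(* If [tau + e < 1], then [t2 = tau + e] would exceed the supremum; hence [t2 = 1] and the whole
   segment is reached. *)
have : t2 <= tau by apply: sup_upper_bound.
have [_] := Q2; rewrite {2}/t2; case: (leP 1 (tau + e)) => [te [d' d'0 Qd] _|_ _]; last lra.
exists d' => //; suff <- : t2 = 1 by [].
by rewrite /t2 min_l.
Qed.

(** The value at [x] is that of the section over the tube to [x]. For [y] near [x], the sections
    over the tubes to [x] and to [y] agree at [y]: the intersection of the tubes is convex and
    contains both [y] and 0, where both sections equal [s0 0]. *)
Lemma global_good : exists s, good setT s.
Proof.
have [s0 tubeP] := tube_good.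
have /choice[p pP] : forall x, exists p : R * (forall x, T x),
    [/\ 0 < p.1, good (tube x 1 p.1) p.2 & p.2 0 = s0 0].
  by move=> x; have [d d0 [s gs s00]] := tubeP x; exists (d, s).
exists (fun x => (p x).2 x); apply: good_local; first exact: openT.
move=> x _; have [d0 gs s00] := pP x.
have i1 : 0 <= (1 : R) <= 1 by rewrite ler01 lexx.
have i0 : 0 <= (0 : R) <= 1 by rewrite ler01 lexx.
have Btube : ball x (p x).1 `<=` tube x 1 (p x).1.
  by move=> y; rewrite -ball_normE /= distrC => xy; exists 1; rewrite ?scale1r.
have tube0 y d : 0 < d -> tube y 1 d 0.
  by move=> dgt0; exists 0; rewrite // scale0r subrr normr0.
have tube1 y d : 0 < d -> tube y 1 d y.
  by move=> dgt0; exists 1; rewrite // scale1r subrr normr0.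
exists (ball x (p x).1), (p x).2; split.
- exact: ball_open.
- exact: ballxx.
- by apply: good_sub gs => //; exact: ball_open.
move=> y xy _; have [e0 gs' s'00] := pP y.
pose W := tube y 1 (p y).1 `&` tube x 1 (p x).1.
have oW : open W by apply: openI; exact: open_tube.
apply: (good_rigid (W := W) (x := 0)) => //.
- by apply: segment_closedI; exact: tube_segment_closed.
- by apply: good_sub gs' => // z [].
- by apply: good_sub gs => // z [].
- by split; exact: tube0.
- by rewrite s'00.
- by split; [exact: tube1|exact: Btube].
Qed.

End Monodromy.

(** * Complex-valued functions *)

Section ComplexCalculus.
Variables (R : realType) (V : normedModType R).
Implicit Types (f g : V -> R[i]) (x y u v : V) (U W : set V).

Lemma ReM (z w : R[i]) : complex.Re (z * w) =
  complex.Re z * complex.Re w - complex.Im z * complex.Im w.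
Proof. by case: z w => [a b] [c d]. Qed.

Lemma ImM (z w : R[i]) : complex.Im (z * w) =
  complex.Re z * complex.Im w + complex.Im z * complex.Re w.
Proof. by case: z w => [a b] [c d]. Qed.

Lemma ReD (z w : R[i]) : complex.Re (z + w) = complex.Re z + complex.Re w.
Proof. by case: z w => [a b] [c d]. Qed.

Lemma ImD (z w : R[i]) : complex.Im (z + w) = complex.Im z + complex.Im w.
Proof. by case: z w => [a b] [c d]. Qed.

Lemma Re_conj (z : R[i]) : complex.Re z^* = complex.Re z.
Proof. by case: z. Qed.

Lemma Im_conj (z : R[i]) : complex.Im z^* = - complex.Im z.
Proof. by case: z. Qed.

Lemma conjM (z w : R[i]) : (z * w)^* = z^* * w^*.
Proof. exact: rmorphM. Qed.

Lemma conjD (z w : R[i]) : (z + w)^* = z^* + w^*.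
Proof. exact: rmorphD. Qed.

Lemma complexP (z w : R[i]) : complex.Re z = complex.Re w ->
  complex.Im z = complex.Im w -> z = w.
Proof. by case: z w => [a b] [c d] /= -> ->. Qed.

Lemma smooth_ext U f g : open U -> (forall x, U x -> f x = g x) ->
  smooth_on U f -> smooth_on U g.
Proof.
move=> oU fg sf k; have [fr fi] := sf k.
by split; [apply: Ck_ext fr|apply: Ck_ext fi] => // x /fg ->.
Qed.

Lemma smooth_sub U W f : W `<=` U -> smooth_on U f -> smooth_on W f.
Proof. by move=> WU sf k; have [fr fi] := sf k; split; exact: Ck_sub WU _. Qed.

Lemma smooth_local W f :
  (forall x, W x -> exists2 U, U x & smooth_on U f) -> smooth_on W f.
Proof.
by move=> H k; split; apply: Ck_local => x /H[U Ux sf]; exists U => //; have [] := sf k.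
Qed.

Lemma smooth_add U f g : open U -> smooth_on U f -> smooth_on U g ->
  smooth_on U (fun x => f x + g x).
Proof.
move=> oU sf sg k; have [fr fi] := sf k; have [gr gi] := sg k; split.
- by apply: Ck_ext (Ck_lin 1 1 oU fr gr) => // x _; rewrite !mul1r ReD.
- by apply: Ck_ext (Ck_lin 1 1 oU fi gi) => // x _; rewrite !mul1r ImD.
Qed.

Lemma smooth_mul U f g : open U -> smooth_on U f -> smooth_on U g ->
  smooth_on U (fun x => f x * g x).
Proof.
move=> oU sf sg k; have [fr fi] := sf k; have [gr gi] := sg k; split.
- apply: Ck_ext (Ck_lin 1 (- 1) oU (Ck_mul oU fr gr) (Ck_mul oU fi gi)) => // x _.
  by rewrite !mul1r mulN1r ReM.
- apply: Ck_ext (Ck_lin 1 1 oU (Ck_mul oU fr gi) (Ck_mul oU fi gr)) => // x _.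
  by rewrite !mul1r ImM.
Qed.

Lemma smooth_conj U f : open U -> smooth_on U f -> smooth_on U (fun x => (f x)^*).
Proof.
move=> oU sf k; have [fr fi] := sf k; split.
  by apply: Ck_ext fr => // x _; rewrite Re_conj.
apply: Ck_ext (Ck_lin (- 1) 0 oU fi fi) => // x _.
by rewrite mul0r addr0 mulN1r Im_conj.
Qed.

Lemma smooth_cderive U v f : smooth_on U f -> smooth_on U (cderive v f).
Proof. by move=> sf k; have [fr fi] := sf k.+1; split; exact: Ck_derive. Qed.

Lemma smooth_Ck1 U f : smooth_on U f ->
  Ck 1 U (fun x => complex.Re (f x)) /\ Ck 1 U (fun x => complex.Im (f x)).
Proof. by move=> /(_ 1%N). Qed.

Lemma cderive_near f g v x : (\forall y \near x, f y = g y) ->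
  cderive v f x = cderive v g x.
Proof.
move=> fg; rewrite /cderive; congr (_ +i* _)%C;
  by apply: near_eq_derive; apply: filterS fg => y ->.
Qed.

Lemma cderive_eq_on U f g v x : open U -> U x -> (forall y, U y -> f y = g y) ->
  cderive v f x = cderive v g x.
Proof.
move=> oU Ux fg; apply: cderive_near.
by apply: filterS (open_nbhs_nbhs (conj oU Ux)) => y; exact: fg.
Qed.

Lemma cderiveD U f g v x : smooth_on U f -> smooth_on U g -> U x ->
  cderive v (fun y => f y + g y) x = cderive v f x + cderive v g x.
Proof.
move=> /smooth_Ck1[fr fi] /smooth_Ck1[gr gi] Ux; apply: complexP; rewrite ?ReD ?ImD /=.
- under eq_fun do rewrite ReD.
  by have E := deriveD (Ck_derivable v fr Ux) (Ck_derivable v gr Ux); exact: E.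
- under eq_fun do rewrite ImD.
  by have E := deriveD (Ck_derivable v fi Ux) (Ck_derivable v gi Ux); exact: E.
Qed.

Lemma cderiveM U f g v x : smooth_on U f -> smooth_on U g -> U x ->
  cderive v (fun y => f y * g y) x = cderive v f x * g x + f x * cderive v g x.
Proof.
move=> /smooth_Ck1[fr fi] /smooth_Ck1[gr gi] Ux.
have [frd fid] := (derivableP (Ck_derivable v fr Ux), derivableP (Ck_derivable v fi Ux)).
have [grd gid] := (derivableP (Ck_derivable v gr Ux), derivableP (Ck_derivable v gi Ux)).
apply: complexP; rewrite ?ReD ?ImD ?ReM ?ImM /=.
- under eq_fun do rewrite ReM.
  have [_ E] := is_deriveB (is_deriveM frd grd) (is_deriveM fid gid).
  apply: etrans E _.
  by rewrite -![_ *: _]/(_ * _); ring.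
- under eq_fun do rewrite ImM.
  have [_ E] := is_deriveD (is_deriveM frd gid) (is_deriveM fid grd).
  apply: etrans E _.
  by rewrite -![_ *: _]/(_ * _); ring.
Qed.

Lemma cderive_conj U f v x : smooth_on U f -> U x ->
  cderive v (fun y => (f y)^*) x = (cderive v f x)^*.
Proof.
move=> /smooth_Ck1[fr fi] Ux; apply: complexP; rewrite ?Re_conj ?Im_conj /=.
  by under eq_fun do rewrite Re_conj.
under eq_fun do rewrite Im_conj.
by have E := deriveN (Ck_derivable v fi Ux); exact: E.
Qed.

Lemma RCM (a : R) (z : R[i]) : (a%:C)%C * z = (a * complex.Re z +i* (a * complex.Im z))%C.
Proof. by apply: complexP; rewrite ?ReM ?ImM /= mul0r ?subr0 ?addr0. Qed.

Lemma cderive_lin U f (a : R) u v x : open U -> smooth_on U f -> U x ->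
  cderive (a *: u + v) f x = (a%:C)%C * cderive u f x + cderive v f x.
Proof.
move=> oU /smooth_Ck1[fr fi] Ux; rewrite RCM.
by apply: complexP; rewrite ?ReD ?ImD /= (derive_lin _ _ _ oU).
Qed.

Lemma cderive_comm U f u v x : open U -> smooth_on U f -> U x ->
  cderive v (cderive u f) x = cderive u (cderive v f) x.
Proof.
move=> oU /(_ 2%N)[fr fi] Ux.
have Er := derive_comm u v oU fr Ux; have Ei := derive_comm u v oU fi Ux.
by rewrite /cderive /= Er Ei.
Qed.

Lemma cderive0_cst W f : segment_closed W -> smooth_on W f ->
  (forall x v, W x -> cderive v f x = 0) -> forall x y, W x -> W y -> f x = f y.
Proof.
move=> cW /smooth_Ck1[fr fi] fd x y Wx Wy.
apply: complexP.
- apply: (is_derive_cst_on (f := fun z => complex.Re (f z)) cW) => // z v Wz.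
  by split; [exact: Ck_derivable fr Wz|exact: (congr1 (@complex.Re R) (fd z v Wz))].
- apply: (is_derive_cst_on (f := fun z => complex.Im (f z)) cW) => // z v Wz.
  by split; [exact: Ck_derivable fi Wz|exact: (congr1 (@complex.Im R) (fd z v Wz))].
Qed.

End ComplexCalculus.

Section ComplexLinearMaps.
Variables (R : realType) (V V' : normedModType R).
Implicit Types (f : V' -> R[i]) (B : V -> V') (x v : V) (W : set V').

Lemma smooth_comp_linear W f B :
  linear B -> continuous B -> smooth_on W f -> smooth_on (B @^-1` W) (f \o B).
Proof.
by move=> lB cB sf k; have [fr fi] := sf k; split; [exact: Ck_comp_linear fr|exact: Ck_comp_linear fi].
Qed.

Lemma cderive_comp_linear f B x v :
  linear B -> cderive v (f \o B) x = cderive (B v) f (B x).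
Proof.
move=> lB; rewrite /cderive.
have [_ <-] := derivable_comp_linear (fun y => complex.Re (f y)) x v lB.
by have [_ <-] := derivable_comp_linear (fun y => complex.Im (f y)) x v lB.
Qed.

End ComplexLinearMaps.

(** * The symmetric gauge *)

Section Gauge.
Variable R : realType.
Local Notation C := R[i].
Local Notation M := (phase_space R).
Implicit Types (x y u v : M) (U W : set M) (hbar : R).

Lemma omegaE x v : omega x v =
  (x 0 1 * v 0 0 - v 0 1 * x 0 0) + (x 1 1 * v 1 0 - v 1 1 * x 1 0).
Proof. rewrite /omega big_ord_recl big_ord1.
by have -> : fintype.lift ord0 ord0 = 1 :> 'I_2 by exact: val_inj. Qed.

Lemma omega_linl v : linear (fun x : M => omega x v).
Proof. by move=> k x y; rewrite !omegaE !mxE -[k *: _]/(k * _); ring. Qed.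

Lemma omega_linr x : linear (omega x).
Proof. by move=> k u v; rewrite !omegaE !mxE -[k *: _]/(k * _); ring. Qed.

Lemma omegaC x v : omega v x = - omega x v.
Proof. by rewrite !omegaE; ring. Qed.

Lemma omega_continuous v : continuous (fun x : M => omega x v).
Proof.
move=> x; under eq_fun do rewrite omegaE.
have cr i j a : {for x, continuous (fun y : M => y i j * a)}.
  by apply: continuousM; [exact: coord_continuous|exact: cst_continuous].
have cl i j a : {for x, continuous (fun y : M => a * y i j)}.
  by apply: continuousM; [exact: cst_continuous|exact: coord_continuous].
have c0 := continuousB (cr 0 1 (v 0 0)) (cl 0 0 (v 0 1)).
have c1 := continuousB (cr 1 1 (v 1 0)) (cl 1 0 (v 1 1)).
exact: continuousD c0 c1.
Qed.

(* The symmetric gauge potential of the uniform curvature - (i / hbar) omega. *)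
Definition theta hbar v x : C := (0 +i* (- (2 * hbar)^-1 * omega x v))%C.

Lemma smooth_theta hbar v U : open U -> smooth_on U (theta hbar v).
Proof.
move=> oU k; split; first exact: Ck_cst.
have oC : Ck k U (fun x : M => omega x v) by apply: Ck_linear; [exact: omega_linl|exact: omega_continuous].
apply: Ck_ext (Ck_lin (- (2 * hbar)^-1) 0 oU oC oC) => // x _.
by rewrite mul0r addr0.
Qed.

Lemma cderive_theta hbar u v x : cderive u (theta hbar v) x = theta hbar v u.
Proof.
rewrite /cderive /theta /= derive_cst; congr (_ +i* _)%C.
by have [_] := is_deriveZ (- (2 * hbar)^-1) (is_derive_linear x u (omega_linl v)).
Qed.

(** The two terms are equal by antisymmetry of [omega], which accounts for the factor 2 in the
    gauge. *)
Lemma theta_curvature hbar u v : hbar != 0 ->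
  theta hbar v u - theta hbar u v = (0 +i* - (omega u v / hbar))%C.
Proof.
move=> h0; apply: complexP; rewrite /= ?subrr// (omegaC u v).
by field.
Qed.

Lemma theta_lin hbar (k : R) u v x :
  theta hbar (k *: u + v) x = (k%:C)%C * theta hbar u x + theta hbar v x.
Proof.
rewrite RCM; apply: complexP; rewrite /= ?mulr0 ?addr0//.
by rewrite omega_linr -[k *: _]/(k * _); ring.
Qed.

Lemma theta_conj hbar v x : (theta hbar v x)^* = - theta hbar v x.
Proof. by apply: complexP; rewrite ?Re_conj ?Im_conj /= ?oppr0. Qed.


(** Neighbourhoods of a matrix are given entrywise, and each entry of [A *m x] is a linear
    combination of entries of [x]. *)
Lemma continuous_mulmx (A : 'M[R]_2) : continuous (fun x : M => A *m x).
Proof.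
move=> x P [Q Qn QP].
have H (ij : 'I_2 * 'I_2) : nbhs x (fun y : M => Q ij.1 ij.2 ((A *m y) ij.1 ij.2)).
  have : {for x, continuous (fun y : M => (A *m y) ij.1 ij.2)}.
    rewrite (_ : (fun y : M => _) = fun y : M => A ij.1 0 * y 0 ij.2 +
        A ij.1 (fintype.lift ord0 ord0) * y (fintype.lift ord0 ord0) ij.2); last first.
      by apply: funext => y; rewrite mxE big_ord_recl big_ord1.
    have cl i j a : {for x, continuous (fun y : M => a * y i j)}.
      by apply: continuousM; [exact: cst_continuous|exact: coord_continuous].
    exact: continuousD (cl _ _ _) (cl _ _ _).
  by apply; exact: Qn.
suff : nbhs x [set y | P (A *m y)] by [].
by apply: filterS (filter_forall _ H) => y yH; apply: QP => i j; exact: (yH (i, j)).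
Qed.

Lemma act_linear n (g : dihedral n) : linear (@act R n g).
Proof. by move=> k x y; rewrite /act mulmxDr -scalemxAr. Qed.

Lemma act_continuous n (g : dihedral n) : continuous (@act R n g).
Proof. exact: continuous_mulmx. Qed.

Lemma actK n (g : dihedral n) : (1 < n)%N -> cancel (@act R n g) (act g^-1%g).
Proof. by move=> n1 x; rewrite -actM// mulVg act1. Qed.

Lemma actKV n (g : dihedral n) : (1 < n)%N -> cancel (act g^-1%g) (@act R n g).
Proof. by move=> n1 x; rewrite -actM// mulgV act1. Qed.

Lemma dihedral_mx_orthogonal n (g : dihedral n) :
  (dihedral_mx R g)^T *m dihedral_mx R g = 1%:M.
Proof.
rewrite /dihedral_mx rotation_exp; set t := _ *+ _.
have rT : (rotation t)^T = rotation (- t).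
  by apply/matrixP => i j; rewrite !mxE cosN sinN eq_sym;
    case: i => [[|[|//]] ?]; case: j => [[|[|//]] ?]; rewrite /= ?opprK.
have sT : (reflection R)^T = reflection R.
  by apply/matrixP => i j; rewrite !mxE; case: eqVneq => [->|]; rewrite ?eqxx// eq_sym => /negPf ->.
have rr : (rotation t)^T *m rotation t = 1%:M.
  by rewrite rT [LHS](esym (rotationD _ _)) addNr rotation0.
case: (g.2 : bool) => /=; last by rewrite expr0 mulr1.
rewrite expr1 trmx_mul sT mulmxA -(mulmxA _ _^T) rr mulmx1.
exact: (reflection_sqr R).
Qed.

(** Expresses [omega] through the products [u^T *m v] and [v^T *m u], which do not change when an
    orthogonal matrix acts on both vectors. *)
Lemma omega_mulmx u v : omega u v = (u^T *m v) 1 0 - (v^T *m u) 1 0.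
Proof. by rewrite /omega sumrB !mxE; congr (_ - _); apply: eq_bigr => i _; rewrite mxE. Qed.

Lemma omega_act n (g : dihedral n) u v : omega (act g u) (act g v) = omega u v.
Proof.
have E (w z : M) : (act g w)^T *m act g z = w^T *m z.
  rewrite /act [(_ *m w)^T]trmx_mul -mulmxA (mulmxA (dihedral_mx R g)^T).
  by rewrite dihedral_mx_orthogonal mul1mx.
by rewrite !omega_mulmx !E.
Qed.

Lemma theta_act hbar n (g : dihedral n) v x :
  theta hbar (act g v) (act g x) = theta hbar v x.
Proof. by rewrite /theta omega_act. Qed.

End Gauge.

(** * The standard bundle *)

Section StandardBundle.
Variable R : realType.
Local Notation C := R[i].
Local Notation M := (phase_space R).
Implicit Types (x y u v : M) (U W : set M).

Definition std_fiber (x : M) : lmodType C := C^o.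
Definition std_herm x (z w : std_fiber x) : C := (z : C) * (w : C)^*.
Definition std_atlas : set (set M * (forall x, std_fiber x)) :=
  [set (setT, fun=> 1 : C)].

Fact std_herm_linear x (a : C) (z w t : std_fiber x) :
  std_herm (a *: z + w) t = a * std_herm z t + std_herm w t.
Proof. by rewrite /std_herm mulrDl mulrA. Qed.

Fact std_herm_conj x (z w : std_fiber x) : std_herm w z = (std_herm z w)^*.
Proof. by rewrite /std_herm conjM conjCK mulrC. Qed.

Fact std_herm_pos x (z : std_fiber x) : z != 0 -> 0 < std_herm z z.
Proof. by rewrite /std_herm mul_conjC_gt0. Qed.

Fact std_atlas_open U e : std_atlas (U, e) -> open U.
Proof. by case=> -> _; exact: openT. Qed.

Fact std_atlas_cover x : exists U e, std_atlas (U, e) /\ U x.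
Proof. by exists setT, (fun=> 1 : C). Qed.

Fact std_atlas_basis U e x : std_atlas (U, e) -> U x ->
  e x != 0 /\ forall u : std_fiber x, exists a : C, u = a *: e x.
Proof.
case=> _ -> _; split=> [|u]; first exact: (oner_neq0 C).
by exists (u : C); apply: esym; exact: (mulr1 (u : C)).
Qed.

Fact std_atlas_transition U e U' e' : std_atlas (U, e) -> std_atlas (U', e') ->
  exists2 g : M -> C, smooth_on (U `&` U') g & forall x, (U `&` U') x -> e' x = g x *: e x.
Proof.
case=> _ -> [_ ->]; exists (fun=> 1); first exact: smooth_cst.
by move=> x _; rewrite scale1r.
Qed.

Fact std_herm_smooth U e : std_atlas (U, e) -> smooth_on U (fun x => std_herm (e x) (e x)).
Proof. by case=> _ ->; exact: smooth_cst. Qed.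

Definition std_line_bundle : line_bundle R :=
  LineBundle std_herm_linear std_herm_conj std_herm_pos std_atlas_open std_atlas_cover
    std_atlas_basis std_atlas_transition std_herm_smooth.

Lemma smooth_section_std W (s : M -> C) : open W ->
  smooth_section (L := std_line_bundle) W s <-> smooth_on W s.
Proof.
move=> oW; split=> [/(_ _ _ erefl)[f sf fE]|ss U e [-> ->]].
  rewrite setIT in sf fE; apply: smooth_ext sf => // x Wx.
  by rewrite fE//; exact: (esym (mulr1 (f x))).
exists s; first by rewrite setIT.
by move=> x _; exact: (esym (mulr1 (s x))).
Qed.

Variable hbar : R.

Local Notation L := std_line_bundle.

Definition std_nabla v (s : forall x, L x) : forall x, L x :=
  fun x => (cderive v (s : M -> C) x + theta hbar v x * (s x : C) : C).

Fact std_nabla_smooth W v (s : forall x, L x) : open W ->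
  smooth_section (L := L) W s -> smooth_section (L := L) W (std_nabla v s).
Proof.
move=> oW /(smooth_section_std _ oW) ss; apply/(smooth_section_std _ oW).
apply: smooth_add => //; first exact: smooth_cderive.
by apply: smooth_mul => //; exact: smooth_theta.
Qed.

Fact std_nabla_local W v (s t : forall x, L x) : open W ->
  smooth_section (L := L) W s -> smooth_section (L := L) W t ->
  (forall x, W x -> s x = t x) -> forall x, W x -> std_nabla v s x = std_nabla v t x.
Proof.
move=> oW _ _ st x Wx; rewrite /std_nabla st//; congr (_ + _).
exact: cderive_eq_on oW Wx st.
Qed.

Fact std_nabla_dir W (a : R) u v (s : forall x, L x) : open W -> smooth_section (L := L) W s ->
  forall x, W x ->
  std_nabla (a *: u + v) s x = (a%:C)%C *: std_nabla u s x + std_nabla v s x.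
Proof.
move=> oW /(smooth_section_std _ oW) ss x Wx.
rewrite /std_nabla (cderive_lin _ _ _ oW ss Wx) theta_lin.
rewrite -[_ *: _]/(_ * _); ring.
Qed.

Fact std_nablaD W v (s t : forall x, L x) : open W ->
  smooth_section (L := L) W s -> smooth_section (L := L) W t -> forall x, W x ->
  std_nabla v (fun y => s y + t y) x = std_nabla v s x + std_nabla v t x.
Proof.
move=> oW /(smooth_section_std _ oW) ss /(smooth_section_std _ oW) st x Wx.
by rewrite /std_nabla (cderiveD _ ss st Wx); ring.
Qed.

Fact std_nabla_Leibniz W v (f : M -> C) (s : forall x, L x) : open W ->
  smooth_on W f -> smooth_section (L := L) W s -> forall x, W x ->
  std_nabla v (fun y => f y *: s y) x = cderive v f x *: s x + f x *: std_nabla v s x.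
Proof.
move=> oW sf /(smooth_section_std _ oW) ss x Wx.
have E : cderive v (fun y => f y * (s y : C)) x = _ := cderiveM v sf ss Wx.
rewrite /std_nabla [cderive v _ x]E -![_ *: _]/(_ * _); ring.
Qed.

Fact std_nabla_metric W v (s t : forall x, L x) : open W ->
  smooth_section (L := L) W s -> smooth_section (L := L) W t -> forall x, W x ->
  cderive v (fun y => herm (s y) (t y)) x
    = herm (std_nabla v s x) (t x) + herm (s x) (std_nabla v t x).
Proof.
move=> oW /(smooth_section_std _ oW) ss /(smooth_section_std _ oW) st x Wx.
have E : cderive v (fun y => herm (s y) (t y)) x = _ :=
  cderiveM v ss (smooth_conj oW st) Wx.
rewrite E (cderive_conj _ st Wx) /std_nabla /= /std_herm conjD conjM theta_conj.
by move: (t x : C)^* => z; ring.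
Qed.

Definition std_connection : unitary_connection L :=
  UnitaryConnection std_nabla_smooth std_nabla_local std_nabla_dir std_nablaD
    std_nabla_Leibniz std_nabla_metric.

Hypothesis hbar_neq0 : hbar != 0.
Variable n : nat.
Hypothesis n_gt1 : (1 < n)%N.

(** The second derivatives of [s] cancel by symmetry, and the remaining terms are symmetric in [u]
    and [v] except for the derivatives of [theta]. *)
Fact std_curvature : has_curvature std_connection
  (fun u v => (0 +i* - (omega u v / hbar))%C).
Proof.
move=> W u v s oW /(smooth_section_std _ oW) ss x Wx.
have D u' v' : cderive u' (std_nabla v' s : M -> C) x =
    cderive u' (cderive v' (s : M -> C)) x +
    (theta hbar v' u' * (s x : C) + theta hbar v' x * cderive u' (s : M -> C) x).
  have sth : smooth_on W (theta hbar v') by exact: smooth_theta.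
  rewrite (cderiveD u' (smooth_cderive v' ss) (smooth_mul oW sth ss) Wx).
  by rewrite (cderiveM u' sth ss Wx) cderive_theta.
rewrite /= {1 3}/std_nabla !D (cderive_comm u v oW ss Wx).
rewrite -(theta_curvature u v hbar_neq0) /std_nabla -[_ *: _]/(_ * _); ring.
Qed.

(** All fibres are the same copy of the complex numbers, so the identity is a lift over every
    [act g]; it respects the connection because [theta] is invariant. *)
Definition std_lift (g : dihedral n) x : {linear L x -> L (act g x)} := idfun.

Fact std_lift1 x (u : L x) : total (std_lift 1%g x u) = total u.
Proof. by rewrite /total /=; move: (act1 n x) => ->. Qed.

Fact std_liftM g h x (u : L x) :
  total (std_lift (g * h)%g x u) = total (std_lift g (act h x) (std_lift h x u)).
Proof. by rewrite /total /= actM. Qed.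

Fact std_lift_herm g x (u v : L x) :
  herm (std_lift g x u) (std_lift g x v) = herm u v.
Proof. by []. Qed.

Let pushE g (s t : forall x, L x) : (forall x, t (act g x) = std_lift g x (s x)) ->
  (t : M -> C) = (s : M -> C) \o act g^-1%g.
Proof. by move=> st; apply: funext => y /=; rewrite -[in LHS](actKV g n_gt1 y) st. Qed.

Fact std_lift_smooth g W (s t : forall x, L x) : open W ->
  (forall x, t (act g x) = std_lift g x (s x)) ->
  smooth_section (L := L) (act g @^-1` W) s -> smooth_section (L := L) W t.
Proof.
move=> oW st; have oW' : open (act g @^-1` W).
  by apply: open_comp => // x _; exact: act_continuous.
move=> /(smooth_section_std _ oW') ss; apply/(smooth_section_std _ oW).
rewrite (pushE st); apply: smooth_sub (smooth_comp_linear (@act_linear _ _ _) (@act_continuous _ _ _) ss).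
by move=> x Wx; rewrite /preimage /= actKV.
Qed.

Fact std_lift_connection g W v (s t : forall x, L x) : open W ->
  (forall x, t (act g x) = std_lift g x (s x)) ->
  smooth_section (L := L) (act g @^-1` W) s -> forall x, W (act g x) ->
  std_connection (act g v) t (act g x) = std_lift g x (std_connection v s x).
Proof.
move=> oW st ss x Wx; rewrite /= /std_nabla theta_act st; congr (_ + _).
rewrite (pushE st) cderive_comp_linear; last exact: act_linear.
by rewrite !actK.
Qed.

Definition std_bundle : prequantum_bundle hbar n :=
  PrequantumBundle std_curvature std_lift1 std_liftM std_lift_herm
    std_lift_smooth std_lift_connection.

End StandardBundle.

(** * Parallel sections *)

Section ParallelFrames.
Variables (R : realType) (hbar : R) (n : nat) (L : prequantum_bundle hbar n).
Local Notation C := R[i].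
Local Notation M := (phase_space R).
Local Notation nb := (connection L).
Implicit Types (x y u v : M) (U W : set M) (s t : forall x, L x).

Lemma scaler_fiberI x (a b : C) (u : L x) : u != 0 -> a *: u = b *: u -> a = b.
Proof.
move=> u0 /eqP; rewrite -subr_eq0 -scalerBl scaler_eq0 (negPf u0) orbF subr_eq0.
by move/eqP.
Qed.

Lemma herm_0l x (u : L x) : herm 0 u = 0.
Proof. by have := hermZ 0 1 (0 : L x) u; rewrite scaler0 scale1r !mul0r. Qed.

Lemma herm_Zl x (a : C) (u w : L x) : herm (a *: u) w = a * herm u w.
Proof. by have := hermZ a 1 u w; rewrite scale1r conjC1 mulr1. Qed.

Lemma fiber_scalar x (s u : L x) : s != 0 -> exists a : C, u = a *: s.
Proof.
move=> s0; have [U [e [Ue Ux]]] := atlas_cover L x.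
have [e0 eb] := atlas_basis Ue Ux.
have [a ua] := eb u; have [b sb] := eb s; exists (a / b).
have b0 : b != 0 by apply: contraNneq s0 => b0; rewrite sb b0 scale0r.
by rewrite sb scalerA divfK.
Qed.

Lemma unit_neq0 x (s : L x) : herm s s = 1 -> s != 0.
Proof. by apply: contra_eqN => /eqP ->; rewrite herm_0l eq_sym oner_neq0. Qed.

Lemma unit_frameE x (s u : L x) : herm s s = 1 -> u = herm u s *: s.
Proof.
by move=> s1; have [a ->] := fiber_scalar u (unit_neq0 s1); rewrite herm_Zl s1 mulr1.
Qed.

Lemma smooth_section_sub W W' s : W' `<=` W -> smooth_section W s -> smooth_section W' s.
Proof.
move=> W'W ss U e Ue; have [f sf fE] := ss U e Ue; exists f.
  by apply: smooth_sub sf => x [/W'W].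
by move=> x [/W'W Wx Ux]; exact: fE.
Qed.

(** The coefficient of [s] in an atlas frame is chosen pointwise. As the frame vanishes nowhere, it
    coincides near each point with the smooth coefficient of the local model. *)
Lemma smooth_section_local W s : open W ->
  (forall x, W x -> exists W' s', [/\ open W', W' x, smooth_section W' s' &
    forall y, W' y -> W y -> s y = s' y]) -> smooth_section W s.
Proof.
move=> oW H U e Ue; have oU := atlas_open Ue.
have /choice[f fE] : forall x, exists a : C, (W `&` U) x -> s x = a *: e x.
  move=> x; case: (pselect ((W `&` U) x)) => [[_ Ux]|?]; last by exists 0.
  by have [_ /(_ (s x))[a]] := atlas_basis Ue Ux; exists a.
exists f => //; apply: smooth_local => x [Wx Ux].
have [W' [s' [oW' W'x ss' E]]] := H x Wx.
have [f' sf' f'E] := ss' U e Ue.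
exists (W' `&` (W `&` U)) => //.
apply: smooth_ext (smooth_sub _ sf').
- by do 2 apply: openI => //.
- move=> y [W'y [Wy Uy]]; have [e0 _] := atlas_basis Ue Uy.
  by apply: (scaler_fiberI e0); rewrite -fE// -f'E// E.
- by move=> y [W'y [Wy Uy]].
Qed.

Lemma smooth_section_mul W (f : M -> C) s : open W -> smooth_on W f ->
  smooth_section W s -> smooth_section W (fun x => f x *: s x).
Proof.
move=> oW sf ss U e Ue; have [g sg gE] := ss U e Ue; exists (fun x => f x * g x).
  apply: smooth_mul => //; first by apply: openI => //; exact: atlas_open Ue.
  by apply: smooth_sub sf => x [].
by move=> x /gE ->; rewrite scalerA.
Qed.

Lemma smooth_section_frame U (e : forall x, L x) : atlas (U, e) -> smooth_section U e.
Proof. by move=> Ue U' e' Ue'; have [g sg gE] := atlas_transition Ue' Ue; exists g;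
  [rewrite setIC|rewrite setIC]. Qed.

Lemma smooth_herm W s t : open W -> smooth_section W s -> smooth_section W t ->
  smooth_on W (fun x => herm (s x) (t x)).
Proof.
move=> oW ss st; apply: smooth_local => x Wx.
have [U [e [Ue Ux]]] := atlas_cover L x; have oU := atlas_open Ue.
have [f sf fE] := ss U e Ue; have [g sg gE] := st U e Ue.
have oWU : open (W `&` U) by exact: openI.
exists (W `&` U) => //.
apply: (@smooth_ext _ _ _ (fun y => f y * (g y)^* * herm (e y) (e y))) => //.
  by move=> y WUy; rewrite fE// gE// hermZ.
apply: smooth_mul => //; first by apply: smooth_mul => //; exact: smooth_conj.
by apply: smooth_sub (herm_smooth Ue) => y [].
Qed.

(** The word refers to the connection [nb - theta], whose curvature vanishes, rather than to
    [nb]. *)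
Definition parallel W s := smooth_section W s /\
  forall x v, W x -> nb v s x = theta hbar v x *: s x.

Definition unit_parallel W s := parallel W s /\ forall x, W x -> herm (s x) (s x) = 1.

(** [theta] is purely imaginary, so its two contributions to the derivative of the Hermitian product
    cancel. *)
Lemma parallel_herm_cst W s t : open W -> segment_closed W ->
  parallel W s -> parallel W t -> forall x y, W x -> W y ->
  herm (s x) (t x) = herm (s y) (t y).
Proof.
move=> oW cW [ss sp] [ts tp]; apply: (cderive0_cst cW).
  exact: smooth_herm.
move=> x v Wx; rewrite (nabla_metric nb v oW ss ts Wx) sp// tp//.
rewrite herm_Zl; have := hermZ 1 (theta hbar v x) (s x) (t x).
by rewrite scale1r mul1r => ->; rewrite theta_conj mulNr subrr.
Qed.

Lemma parallel_sub W W' s : W' `<=` W -> parallel W s -> parallel W' s.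
Proof.
move=> W'W [ss sp]; split; first exact: smooth_section_sub ss.
by move=> x v /W'W; exact: sp.
Qed.

Lemma unit_parallel_sub W W' s :
  open W' -> W' `<=` W -> unit_parallel W s -> unit_parallel W' s.
Proof.
by move=> oW' W'W [sp s1]; split; [exact: parallel_sub sp|move=> x /W'W /s1].
Qed.

Lemma unit_parallel_local W s : open W ->
  (forall x, W x -> exists W' s', [/\ open W', W' x, unit_parallel W' s' &
    forall y, W' y -> W y -> s y = s' y]) -> unit_parallel W s.
Proof.
move=> oW H; have ss : smooth_section W s.
  apply: smooth_section_local => // x Wx.
  by have [W' [s' [oW' W'x [[ss' _] _] E]]] := H x Wx; exists W', s'.
split; first split=> // x v Wx; last first.
  move=> x Wx; have [W' [s' [oW' W'x [_ s'1] E]]] := H x Wx.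
  by rewrite E// s'1.
have [W' [s' [oW' W'x [[ss' sp'] _] E]]] := H x Wx.
have oI : open (W' `&` W) by exact: openI.
rewrite E// -sp'//; apply: (@nabla_local _ _ nb _ v s s' oI) => //.
- by apply: smooth_section_sub ss => y [].
- by apply: smooth_section_sub ss' => y [].
- by move=> y [W'y Wy]; exact: E.
Qed.

(** In the unit frame [t] the section [s] has the coefficient [herm (s y) (t y)], which is constant
    and equal to 1 at [x]. *)
Lemma unit_parallel_rigid W s t x : open W -> segment_closed W ->
  unit_parallel W s -> unit_parallel W t -> W x -> s x = t x ->
  forall y, W y -> s y = t y.
Proof.
move=> oW cW [sp s1] [tp t1] Wx stx y Wy.
rewrite [LHS](unit_frameE (s y) (t1 y Wy)).
by rewrite (parallel_herm_cst oW cW sp tp Wy Wx) stx t1// scale1r.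
Qed.

Lemma parallelZ W (c : C) s : open W -> parallel W s -> parallel W (fun x => c *: s x).
Proof.
move=> oW [ss sp]; split; first exact: smooth_sectionZ.
by move=> x v Wx; rewrite (nablaZ nb v c oW ss Wx) sp// !scalerA mulrC.
Qed.

End ParallelFrames.

(** * Local primitives *)

Section Exponential.
Variables (R : realType) (V : normedModType R).
Implicit Types (F : V -> R) (x v : V) (W : set V).

Lemma is_derive_comp1 F (g : R -> R) x v (d d' : R) :
  is_derive x v F d -> is_derive (F x) 1 g d' -> is_derive x v (g \o F) (d * d').
Proof.
rewrite -[x in is_derive x v]add0r -[in X in _ -> X -> _](add0r x) -(scale0r v).
move=> /is_derive_lineP Fd gd; apply/is_derive_lineP.
rewrite mulrC; apply: (is_derive1_comp (f := g) (g := fun s : R => F (s *: v + x))) => //.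
Qed.

(* exp (- (f + i h)) solves the equation D_v G = - (a_v + i b_v) G, whose shape bootstraps
   continuity to smoothness. *)
Definition cexpN (f h : V -> R) x : R[i] :=
  (expR (- f x) * cos (h x) +i* - (expR (- f x) * sin (h x)))%C.

Lemma is_derive_cexpN (f h : V -> R) x v (a b : R) : is_derive x v f a -> is_derive x v h b ->
  is_derive x v (fun y => complex.Re (cexpN f h y))
    (- (a * complex.Re (cexpN f h x) - b * complex.Im (cexpN f h x))) /\
  is_derive x v (fun y => complex.Im (cexpN f h y))
    (- (a * complex.Im (cexpN f h x) + b * complex.Re (cexpN f h x))).
Proof.
move=> fa hb.
have ed : is_derive x v (fun y => expR (- f y)) (- a * expR (- f x)).
  by apply: is_derive_comp1; exact: is_deriveN.
have cd : is_derive x v (fun y => cos (h y)) (b * - sin (h x)) by exact: is_derive_comp1.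
have sd : is_derive x v (fun y => sin (h y)) (b * cos (h x)) by exact: is_derive_comp1.
split.
- apply: is_derive_eq (is_deriveM ed cd) _.
  by rewrite /= -![_ *: _]/(_ * _); ring.
- apply: is_derive_eq (is_deriveN (is_deriveM ed sd)) _.
  by rewrite /= -![_ *: _]/(_ * _); ring.
Qed.

Lemma smooth_cexpN W (f h : V -> R) (a b : V -> V -> R) : open W ->
  (forall v k, Ck k W (a v)) -> (forall v k, Ck k W (b v)) ->
  (forall x v, W x -> is_derive x v f (a v x)) ->
  (forall x v, W x -> is_derive x v h (b v x)) ->
  (forall x, W x -> {for x, continuous f}) -> (forall x, W x -> {for x, continuous h}) ->
  smooth_on W (cexpN f h).
Proof.
move=> oW aC bC fa hb fc hc.
have cR x : W x -> {for x, continuous (fun y => complex.Re (cexpN f h y))}.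
  move=> Wx; apply: continuousM.
    by apply: (continuous_comp (continuousN (fc x Wx))); exact: continuous_expR.
  by apply: (continuous_comp (hc x Wx)); exact: continuous_cos.
have cI x : W x -> {for x, continuous (fun y => complex.Im (cexpN f h y))}.
  move=> Wx; apply: continuousN; apply: continuousM.
    by apply: (continuous_comp (continuousN (fc x Wx))); exact: continuous_expR.
  by apply: (continuous_comp (hc x Wx)); exact: continuous_sin.
have dR x v Wx := is_derive_cexpN (fa x v Wx) (hb x v Wx).
(* Real and imaginary parts are treated together since each derivative involves both; the base case
   is the continuity just proved. *)
elim=> [|k [IHr IHi]]; first by split; split.
split; split=> // v; split.
- by move=> x Wx; have [[]] := dR x v Wx.
- apply: (Ck_ext oW _ (Ck_lin (- 1) 1 oW (Ck_mul oW (aC v k) IHr) (Ck_mul oW (bC v k) IHi))).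
  by move=> x Wx; have [[_ ->] _] := dR x v Wx; rewrite mulN1r mul1r opprB addrC.
- by move=> x Wx; have [_ []] := dR x v Wx.
- apply: (Ck_ext oW _ (Ck_lin (- 1) (- 1) oW (Ck_mul oW (aC v k) IHi) (Ck_mul oW (bC v k) IHr))).
  by move=> x Wx; have [_ [_ ->]] := dR x v Wx; rewrite !mulN1r opprD.
Qed.

Lemma cderive_cexpN (f h : V -> R) x v (z : R[i]) :
  is_derive x v f (complex.Re z) -> is_derive x v h (complex.Im z) ->
  cderive v (cexpN f h) x = - (z * cexpN f h x).
Proof.
move=> fa hb; have [[_ er] [_ ei]] := is_derive_cexpN fa hb.
rewrite /cderive er ei; case: z {fa hb er ei} => a b; case: (cexpN f h x) => c d.
by apply: complexP.
Qed.

Lemma cexpN_neq0 (f h : V -> R) x : cexpN f h x != 0.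
Proof.
rewrite /cexpN eq_complex /= oppr_eq0 !mulf_eq0 gt_eqF ?expR_gt0//=.
apply/negP => /andP[/eqP c0 /eqP s0].
by have := cos2Dsin2 (h x); rewrite c0 s0 expr0n addr0 => /eqP; rewrite eq_sym oner_eq0.
Qed.

End Exponential.

(** * Uniform bounds for linear families, and primitives of closed forms *)

Section LinearBound.
Variable R : realType.
Local Notation M := (phase_space R).

Lemma le_mx_norm (v : M) i j : `|v i j| <= `|v|.
Proof.
rewrite [leRHS]/Num.norm /= mx_normrE.
exact: (le_bigmax _ (fun ij : 'I_2 * 'I_2 => `|v ij.1 ij.2|) (i, j)).
Qed.

(** Expansion in elementary matrices: bounds on finitely many directions give a bound uniform in all
    directions. *)
Lemma linear_mx_bound (l : M -> R) (k : 'I_2 * 'I_2 -> R) (v : M) : linear l ->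
  (forall ij, `|l (delta_mx ij.1 ij.2)| <= k ij) -> `|l v| <= (\sum_ij k ij) * `|v|.
Proof.
move=> ll lk.
pose ll' : {linear M -> R^o} := HB.pack l (GRing.isLinear.Build _ _ _ _ l ll).
have -> : l v = \sum_ij v ij.1 ij.2 * l (delta_mx ij.1 ij.2).
  transitivity (ll' v); first by [].
  rewrite {1}[v]matrix_sum_delta pair_bigA linear_sum.
  by apply: eq_bigr => ij _; rewrite linearZ.
apply: le_trans (ler_norm_sum _ _ _) _; rewrite mulr_suml; apply: ler_sum => ij _.
by rewrite normrM mulrC; apply: ler_pM => //; exact: le_mx_norm.
Qed.

End LinearBound.

Section LinearFamilies.
Variable R : realType.
Local Notation M := (phase_space R).
Variables (U : set M) (a : M -> M -> R) (p : M).
Hypotheses (oU : open U) (Up : U p).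
Hypothesis a_lin : forall y, U y -> linear (a ^~ y : M -> R).
Hypothesis aC : forall v, Ck 1 U (a v).
Hypothesis a_closed : forall u v y, U y -> 'D_u (a v) y = 'D_v (a u) y.

Let near_bound (b : M -> M -> R) : (forall v, {for p, continuous (b v)}) ->
  \forall y \near p, forall ij : 'I_2 * 'I_2,
    `|b (delta_mx ij.1 ij.2) y| <= `|b (delta_mx ij.1 ij.2) p| + 1.
Proof.
move=> bc; pose B (ij : 'I_2 * 'I_2) : set M := fun y =>
  `|b (delta_mx ij.1 ij.2) y| <= `|b (delta_mx ij.1 ij.2) p| + 1.
apply: (@filter_forall _ _ B (nbhs p)) => ij.
have /cvgrPdist_le /(_ _ ltr01) := bc (delta_mx ij.1 ij.2).
apply: filterS => y yp; rewrite /B -lerBlDl; apply: le_trans yp.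
by rewrite distrC lerB_dist.
Qed.

(** Continuity at [p] bounds the finitely many values on elementary matrices near [p]; linearity
    extends these bounds to all directions. *)
Lemma linear_family_bound : exists K, \forall y \near p,
  [/\ U y, forall v, `|a v y| <= K * `|v| &
      forall u v, `|'D_u (a v) y| <= K * `|u| * `|v|].
Proof.
have nU := open_nbhs_nbhs (conj oU Up).
pose D ij := \sum_kl (`|'D_(delta_mx kl.1 kl.2) (a (delta_mx ij.1 ij.2)) p| + 1).
pose K := \sum_ij (`|a (delta_mx ij.1 ij.2) p| + 1) + \sum_(ij : 'I_2 * 'I_2) D ij.
have D0 ij : 0 <= D ij by apply: sumr_ge0 => kl _; rewrite addr_ge0.
exists K; near=> y; have Uy : U y by near: y.
have Dlin v : linear (fun u => 'D_u (a v) y).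
  by move=> k u w; exact: (derive_lin k u w oU (aC v) Uy).
split=> // [v|u v].
  apply: (@le_trans _ _ ((\sum_ij (`|a (delta_mx ij.1 ij.2) p| + 1)) * `|v|)).
    apply: (linear_mx_bound _ (a_lin Uy)); near: y; apply: near_bound => w.
    exact: Ck_cont (aC w) Up.
  by rewrite ler_wpM2r// lerDl sumr_ge0.
apply: (@le_trans _ _ ((\sum_ij (D ij * `|u|)) * `|v|)).
  apply: (linear_mx_bound (l := fun v => 'D_u (a v) y)).
    (* Closedness exchanges [u] and [v], so linearity in [v] follows from linearity of the
       derivative in its direction. *)
    by move=> k w w'; rewrite !(a_closed u _ Uy); exact: Dlin.
  move=> ij; apply: (linear_mx_bound _ (Dlin _)) => kl.
  move: ij kl; near: y.
  apply: (@filter_forall _ _ (fun (ij : 'I_2 * 'I_2) (y : M) => forall kl : 'I_2 * 'I_2,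
    `|'D_(delta_mx kl.1 kl.2) (a (delta_mx ij.1 ij.2)) y| <=
    `|'D_(delta_mx kl.1 kl.2) (a (delta_mx ij.1 ij.2)) p| + 1) (nbhs p)) => ij.
  apply: (@near_bound (fun u => 'D_u (a (delta_mx ij.1 ij.2)))) => w.
  exact: Ck_cont (Ck_derive w (aC _)) Up.
by rewrite -mulr_suml ler_wpM2r// ler_wpM2r// lerDr sumr_ge0.
Unshelve. all: end_near. Qed.

Lemma local_primitive : exists2 r, 0 < r /\ ball p r `<=` U & exists F : M -> R,
  (forall y, ball p r y -> {for y, continuous F}) /\
  (forall y v, ball p r y -> is_derive y v F (a v y)).
Proof.
have [K /nbhs_ballP[r /= r0 rB]] := linear_family_bound.
have BU : ball p r `<=` U by move=> y /rB[].
have ab v y : ball p r y -> `|a v y| <= K * `|v| by move=> /rB[].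
have FD y v : ball p r y -> is_derive y v (radial_primitive p a) (a v y).
  apply: (@is_derive_radial_primitive _ _ p r K a) => //.
  - by move=> k u w z /BU Uz; exact: a_lin.
  - by move=> w; exact: Ck_sub (aC w).
  - by move=> u w z /BU; exact: a_closed.
  - by move=> u w z /rB[].
exists r => //; exists (radial_primitive p a); split=> // y By.
exact: (is_derive_bounded_continuous ab) FD By.
Qed.

End LinearFamilies.

(** * Global parallel sections *)

Section GlobalFrame.
Variables (R : realType) (hbar : R) (n : nat) (L : prequantum_bundle hbar n).
Hypothesis hbar_neq0 : hbar != 0.
Local Notation C := R[i].
Local Notation M := (phase_space R).
Local Notation nb := (connection L).
Implicit Types (x y u v p : M) (U W : set M) (s t : forall x, L x).

Lemma connection_form U (e : forall x, L x) : atlas (U, e) ->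
  exists A : M -> M -> C, [/\ forall v, smooth_on U (A v),
    forall v x, U x -> nb v e x = A v x *: e x,
    forall (k : R) u v x, U x -> A (k *: u + v) x = (k%:C)%C * A u x + A v x &
    forall u v x, U x -> cderive u (A v) x - cderive v (A u) x
      = (0 +i* - (omega u v / hbar))%C].
Proof.
move=> Ue; have oU := atlas_open Ue; have se := smooth_section_frame Ue.
have snb v : smooth_section U (nb v e) by exact: nabla_smooth.
have /choice[A AP] : forall v, exists f : M -> C,
    smooth_on U f /\ forall x, U x -> nb v e x = f x *: e x.
  by move=> v; have [f] := snb v U e Ue; rewrite setIid => sf fE; exists f.
have sA v : smooth_on U (A v) by have [] := AP v.
have AE v x : U x -> nb v e x = A v x *: e x by have [_] := AP v; apply.
have e0 x : U x -> e x != 0 by move=> Ux; have [] := atlas_basis Ue Ux.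
exists A; split=> // [k u v x Ux|u v x Ux].
  apply: (scaler_fiberI (e0 x Ux)).
  by rewrite scalerDl -scalerA -!AE// (nabla_dir nb k u v oU se Ux).
have nn u' v' : nb u' (nb v' e) x = (cderive u' (A v') x + A v' x * A u' x) *: e x.
  have sAe := smooth_section_mul oU (sA v') se.
  rewrite (nabla_local nb u' oU (snb v') sAe (AE v') Ux).
  by rewrite (nabla_Leibniz nb u' oU (sA v') se Ux) AE// scalerA -scalerDl.
apply: (scaler_fiberI (e0 x Ux)).
rewrite -(curvature u v oU se Ux) !nn -scalerBl; congr (_ *: _); ring.
Qed.

Lemma local_parallel p : exists2 r, 0 < r & exists2 s : forall x, L x, parallel (ball p r) s & s p != 0.
Proof.
have [U [e [Ue Up]]] := atlas_cover L p.
have oU := atlas_open Ue; have se := smooth_section_frame Ue.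
have [A [sA AE A_lin A_curv]] := connection_form Ue.
(* [A] and [theta] have the same antisymmetrized derivative, given by the curvature, so their
   difference is closed. *)
pose a v x := A v x + (- 1) * theta hbar v x.
have sth v W : open W -> smooth_on W (fun x => (- 1) * theta hbar v x).
  by move=> oW; apply: smooth_mul => //; [exact: smooth_cst|exact: smooth_theta].
have sa v : smooth_on U (a v) by apply: smooth_add => //; exact: sth.
have a_lin (k : R) u v x : U x -> a (k *: u + v) x = (k%:C)%C * a u x + a v x.
  by move=> Ux; rewrite /a A_lin// theta_lin; ring.
have da u v x : U x -> cderive u (a v) x = cderive u (A v) x - theta hbar v u.
  move=> Ux; rewrite (cderiveD u (sA v) (sth v U oU) Ux).
  rewrite (cderiveM u (smooth_cst U _) (smooth_theta hbar v oU) Ux).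
  by rewrite cderive_cst cderive_theta mul0r add0r mulN1r.
have a_closed u v x : U x -> cderive u (a v) x = cderive v (a u) x.
  move=> Ux; rewrite !da//; apply/eqP; rewrite -subr_eq0.
  have := A_curv u v x Ux; rewrite -(theta_curvature u v hbar_neq0) => /eqP.
  rewrite -subr_eq0 => /eqP E; apply/eqP; rewrite -[RHS]E; ring.
have aC v := smooth_Ck1 (sa v).
(* The frame [e] need not have norm one, so [a] may have a real part; real and imaginary parts get
   separate primitives. *)
have [|||r1 [r10 r1U] [F [Fc FD]]] :=
    @local_primitive R U (fun v x => complex.Re (a v x)) p oU Up.
- by move=> y Uy k u v; rewrite a_lin// ReD RCM.
- by move=> v; have [] := aC v.
- by move=> u v y Uy; exact: (congr1 (@complex.Re R) (a_closed u v y Uy)).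
have [|||r2 [r20 r2U] [H [Hc HD]]] :=
    @local_primitive R U (fun v x => complex.Im (a v x)) p oU Up.
- by move=> y Uy k u v; rewrite a_lin// ImD RCM.
- by move=> v; have [] := aC v.
- by move=> u v y Uy; exact: (congr1 (@complex.Im R) (a_closed u v y Uy)).
pose r := Num.min r1 r2.
have r0 : 0 < r by rewrite lt_min r10.
have B1 : ball p r `<=` ball p r1 by apply: le_ball; rewrite ge_min lexx.
have B2 : ball p r `<=` ball p r2 by apply: le_ball; rewrite ge_min lexx orbT.
have BU : ball p r `<=` U by move=> x /B1 /r1U.
have oB : open (ball p r) by exact: ball_open.
(* Multiplying [e] by a solution of [D_v G = - a_v G] changes the connection form from [A] to
   [A - a], which is [theta]. *)
pose G := cexpN F H.
have sG : smooth_on (ball p r) G.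
  apply: (smooth_cexpN oB (a := fun v x => complex.Re (a v x))
    (b := fun v x => complex.Im (a v x))).
  - by move=> v k; have [+ _] := sa v k; exact: Ck_sub.
  - by move=> v k; have [_ +] := sa v k; exact: Ck_sub.
  - by move=> x v /B1; exact: FD.
  - by move=> x v /B2; exact: HD.
  - by move=> x /B1; exact: Fc.
  - by move=> x /B2; exact: Hc.
have dG v x : ball p r x -> cderive v G x = - (a v x * G x).
  by move=> Bx; apply: cderive_cexpN; [exact: FD (B1 _ Bx)|exact: HD (B2 _ Bx)].
have seB : smooth_section (ball p r) e by exact: smooth_section_sub se.
exists r => //; exists (fun x => G x *: e x); last first.
  by rewrite scaler_eq0 negb_or cexpN_neq0; have [] := atlas_basis Ue Up.
split; first exact: smooth_section_mul.
move=> x v Bx; rewrite (nabla_Leibniz nb v oB sG seB Bx) dG// AE; last exact: BU.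
by rewrite !scalerA -scalerDl /a; congr (_ *: _); ring.
Qed.

(** The Hermitian norm of a parallel section is constant on the ball, so dividing by its value at
    the centre normalizes it throughout. *)
Lemma local_unit_parallel p : exists2 r, 0 < r & exists s : forall x, L x, unit_parallel (ball p r) s.
Proof.
have [r r0 [s sp s0]] := local_parallel p.
exists r => //; pose c := (sqrtC (herm (s p) (s p)))^-1.
have h0 := herm_pos s0.
exists (fun x => c *: s x); split; first exact: (parallelZ _ (@ball_open _ _ _ _)).
move=> x Bx; rewrite hermZ -normCK normfV ger0_norm ?sqrtC_ge0 ?ltW//.
have Bp : ball p r p by exact: ballxx.
rewrite (parallel_herm_cst (@ball_open _ _ _ _) (@ball_segment_closed _ _ _ _) sp sp Bx Bp).
by rewrite exprVn sqrtCK mulVf// gt_eqF.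
Qed.

Lemma global_unit_parallel : exists s : forall x, L x, unit_parallel setT s.
Proof.
apply: (@global_good R (M : normedModType R) (fun x => L x : Type) (@unit_parallel R hbar n L)).
- exact: unit_parallel_sub.
- exact: unit_parallel_local.
- exact: unit_parallel_rigid.
- have [r r0 [s sp]] := local_unit_parallel 0.
  by exists (ball 0 r), s; split=> //; [exact: ball_open|exact: ballxx].
move=> x; have [r r0 [s1 [s1p s1u]]] := local_unit_parallel x.
exists r => // W s y oW [_ su] Wy By.
have E := unit_frameE (s y) (s1u y By).
(* The constant makes the two sections agree at [y]; it has modulus one since both have norm one
   there. *)
exists (fun z => herm (s y) (s1 y) *: s1 z); last by rewrite -E.
split; first exact: (parallelZ _ (@ball_open _ _ _ _)).
move=> z Bz; rewrite hermZ s1u// -[RHS](su y Wy) [in RHS]E hermZ s1u//.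
Qed.

End GlobalFrame.

(** * Classification *)

Section Classification.
Variables (R : realType) (hbar : R) (n : nat).
Hypotheses (hbar_neq0 : hbar != 0) (n_gt1 : (1 < n)%N).
Local Notation C := R[i].
Local Notation M := (phase_space R).
Local Notation L0 := (std_bundle hbar_neq0 n_gt1).
Implicit Types (x y u v : M) (g h : dihedral n) (L : prequantum_bundle hbar n).

Lemma segment_closedT : segment_closed (setT : set M).
Proof. by []. Qed.

(** * The character attached to a global unit parallel section *)

Section Holonomy.
Variables (L : prequantum_bundle hbar n) (S : forall x, L x).
Hypothesis S_par : unit_parallel setT S.

Let S1 x : herm (S x) (S x) = 1.
Proof. by have [_] := S_par; apply. Qed.

Let lift_ratio g x : C := herm (lift L g x (S x)) (S (act g x)).

(* The push-forward of S by g is again parallel, hence a constant multiple of S. *)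
Lemma lift_frame g x : lift L g x (S x) = lift_ratio g 0 *: S (act g x).
Proof.
have [[sS pS] _] := S_par.
(* The push-forward of [S], written as a multiple of [S y] so that its value lies in [L y] without a
   transport along [act g (act g^-1 y) = y]. *)
pose t y := lift_ratio g (act g^-1%g y) *: S y.
have tE y : t (act g y) = lift L g y (S y).
  by rewrite /t (actK g n_gt1); exact/esym/unit_frameE.
have st : smooth_section setT t by apply: lift_smooth (openT) tE _.
have tp : parallel setT t.
  split=> // y v _; rewrite -(actKV g n_gt1 y) -(actKV g n_gt1 v).
  rewrite (lift_connection _ openT tE)// pS// linearZ /=.
  by rewrite -tE (theta_act _ g).
rewrite -[LHS]tE {1}/t (actK g n_gt1); congr (_ *: _).
have ratioE y : lift_ratio g y = herm (t (act g y)) (S (act g y)) by rewrite tE.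
by rewrite !ratioE; exact: (parallel_herm_cst openT segment_closedT tp (proj1 S_par)).
Qed.

Lemma holonomyM g h : lift_ratio (g * h)%g 0 = lift_ratio g 0 * lift_ratio h 0.
Proof.
(* [liftM] is an equality in the total space, its two sides lying over differently written base
   points; pairing with [S] is a function on the total space and turns it into an equality of
   numbers. *)
pose f (p : {y : M & L y}) := herm (projT2 p) (S (projT1 p)).
have := congr1 f (liftM g h (S 0)); rewrite /f /= -/(lift_ratio _ _) => ->.
by rewrite (lift_frame h 0) linearZ /= herm_Zl (lift_frame g) herm_Zl S1 mulr1 mulrC.
Qed.

Lemma holonomy_norm g : `|lift_ratio g 0| = 1.
Proof.
have := lift_herm g (S 0) (S 0); rewrite lift_frame hermZ !S1 mulr1 -normCK.
by move/eqP; rewrite pexpr_eq1// => /eqP.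
Qed.

Definition holonomy : character R (dihedral n) := Character holonomyM holonomy_norm.

(** The isomorphism is the coordinate in the frame [S]. Since [S] has connection form [theta] and is
    multiplied by [holonomy] under the lifts, the structure of [L] becomes that of the twisted
    standard bundle. *)
Lemma frame_equivalent : equivalent L (twist holonomy L0).
Proof.
have [[sS pS] _] := S_par.
pose phi x (u : L x) : C^o := herm u (S x).
have phi_lin x : linear (phi x) by move=> a u v; exact: herm_linear.
pose phiL x : {linear L x -> twist holonomy L0 x} :=
  HB.pack (phi x) (GRing.isLinear.Build _ _ _ _ (phi x) (phi_lin x)).
have phiE x (u : L x) : u = phi x u *: S x by exact: unit_frameE.
exists phiL; split=> /=.
- move=> x; exists (fun z : C => z *: S x) => [u|z]; first exact/esym/phiE.
  by rewrite /phi herm_Zl S1 mulr1.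
- by move=> x u v; rewrite [in RHS](phiE x u) [in RHS](phiE x v) hermZ S1 mulr1.
- move=> W s oW; split=> [ss|/(smooth_section_std _ oW) ss].
    apply/(smooth_section_std _ oW); apply: smooth_herm => //.
    exact: smooth_section_sub sS.
  have -> : s = fun x => phi x (s x) *: S x by apply: functional_extensionality_dep.
  by apply: smooth_section_mul => //; exact: smooth_section_sub sS.
- move=> W v s oW ss x Wx; have sSW : smooth_section W S by exact: smooth_section_sub sS.
  (* The derivative of [herm s S] is [herm (nabla s) S] minus [theta] times [herm s S]; the [theta]
     term of the standard connection restores the difference. *)
  rewrite /std_nabla (nabla_metric (connection L) v oW ss sSW Wx) pS//.
  have := hermZ 1 (theta hbar v x) (s x) (S x).
  by rewrite scale1r mul1r => ->; rewrite theta_conj mulNr subrK.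
- move=> g x u; rewrite {1}(phiE x u) linearZ /= /phi herm_Zl lift_frame herm_Zl S1 mulr1.
  by rewrite mulrC.
Qed.

End Holonomy.

Lemma twist_std_inj (chi chi' : character R (dihedral n)) :
  equivalent (twist chi L0) (twist chi' L0) -> chi = chi'.
Proof.
move=> [phi [_ phi_herm phi_smooth phi_nabla phi_lift]].
pose one : forall x, twist chi L0 x := fun=> (1 : C).
pose c : M -> C := fun x => phi x (one x).
have s1 : smooth_section (L := std_line_bundle R) setT one.
  by apply/(smooth_section_std _ openT); exact: smooth_cst.
have sc : smooth_on setT c.
  by apply/(smooth_section_std c openT); exact: (proj1 (phi_smooth setT one openT) s1).
(* On the constant section 1 the source connection gives [theta] and the target connection gives the
   derivative of [c] plus [theta] times [c]; linearity of [phi] leaves a zero derivative. *)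
have dc x v : cderive v c x = 0.
  have := phi_nabla setT v one openT s1 x I; rewrite /= /std_nabla.
  have -> : cderive v (one : M -> C) x + theta hbar v x * (one x : C)
      = theta hbar v x *: (one x : C^o).
    by rewrite cderive_cst add0r.
  rewrite [LHS](linearZ_LR (phi x)) => /eqP.
  by rewrite -subr_eq0 opprD addrCA subrr addr0 oppr_eq0 => /eqP.
have c_cst x y : c x = c y.
  by apply: (cderive0_cst segment_closedT sc) => // z v _; exact: dc.
have c0 : c 0 != 0.
  have /= := phi_herm 0 (one 0) (one 0).
  rewrite /std_herm -/(c 0) conjC1 mulr1 => E.
  by apply/eqP => c0; move: E; rewrite c0 mul0r => /eqP; rewrite eq_sym oner_eq0.
apply: character_ext => g.
(* Equivariance at the origin compares [chi g] times [c (act g 0)] with [chi' g] times [c 0]; these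
   values of [c] are equal and nonzero. *)
have := phi_lift g 0 (one 0); rewrite /= [LHS](linearZ_LR (phi (act g 0))) /=.
rewrite -/(c 0) -[phi _ _]/(c (act g 0)) (c_cst (act g 0) 0).
by move/(mulIf c0).
Qed.

Lemma twist_classification L : exists! chi, equivalent L (twist chi L0).
Proof.
have [S S_par] := global_unit_parallel L hbar_neq0.
exists (holonomy S_par); split; first exact: frame_equivalent.
move=> chi eq_chi; apply: twist_std_inj.
by apply: equivalent_trans eq_chi; apply: equivalent_sym; exact: frame_equivalent.
Qed.

End Classification.

Theorem proposition6p4 (R : realType) (hbar : R) (hbar_gt0 : 0 < hbar)
    (n : nat) (n_ge2 : (2 <= n)%N) :
  [/\ exists L0 : prequantum_bundle hbar n, forall L : prequantum_bundle hbar n,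
        exists! chi : character R (dihedral n), equivalent L (twist chi L0),
      forall chi : character R (dihedral n),
        exists! psi : character R (abelianization (dihedral n)),
          chi = pullback_ab psi &
      exists S : 'I_(if odd n then 2%N else 4%N) -> prequantum_bundle hbar n,
        forall L : prequantum_bundle hbar n, exists! i, equivalent L (S i)].
Proof.
have hbar_neq0 : hbar != 0 by rewrite gt_eqF.
have cls := @twist_classification R hbar n hbar_neq0 n_ge2.
split; first by exists (std_bundle hbar_neq0 n_ge2).
  by move=> chi; exact: pullback_ab_bij.
exists (fun i => twist (nth_char R n_ge2 i) (std_bundle hbar_neq0 n_ge2)) => L.
have [chi [eq_chi chi_uniq]] := cls L.
have [i [chi_i i_uniq]] := nth_char_bij n_ge2 chi.
exists i; split; first by rewrite -chi_i.
by move=> j eq_j; apply: i_uniq; exact: chi_uniq.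
Qed.
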